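(* Let $q\in L^1(0,1)$ be real-valued, extended by $0$ to $(1,\infty)$, and let $q_e(x)=q(|x|)$ for $x\in\mathbb R$. Let $\mathcal T_ey=-y''+q_ey$ on $L^2(\mathbb R)$, and let $\mathcal E^e_1<\dots<\mathcal E^e_{n_e}<0$ be its negative eigenvalues, $n_e=n_-(\mathcal T_e)$. Let $T,\widetilde T$ be the half-line operators with potential $q$ and $\mu_n,\nu_n,\tau_n,\varrho_n$ the eigenvalues on $[0,1]$, as defined in the context, and put $m=n_-(T)$, $N=n_-(\widetilde T)$. Then the negative eigenvalues of $\mathcal T_e$ coincide with the eigenvalues of $T$ and $\widetilde T$: $$\sigma_d(\mathcal T_e)=\sigma_d(T)\cup\sigma_d(\widetilde T),\qquad n_e=N+m=\begin{cases}2N-1 & \text{if }\tau_N\ge 0,\\ 2N & \text{if }\tau_N<0,\end{cases}$$ and they satisfy $$\nu_0<\mathcal E_1^e<\varrho_1;\quad \tau_1<\mathcal E_2^e<\mu_1;\quad \nu_1<\mathcal E_3^e<\varrho_2;\quad \tau_2<\mathcal E_4^e<\mu_2;\ \dots$$ that is, $\nu_{j-1}<\mathcal E^e_{2j-1}<\varrho_j$ for all $j\ge1$ with $2j-1\le n_e$, and $\tau_j<\mathcal E^e_{2j}<\mu_j$ for all $j\ge 1$ with $2j\le n_e$.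
   Context: $Ty=-y''+qy$ on $L^2(\mathbb R_+)$ with $y(0)=0$; $\widetilde Ty=-y''+qy$ on $L^2(\mathbb R_+)$ with $y'(0)=0$. The operators $T$, $\widetilde T$, $\mathcal T_e$ each have absolutely continuous spectrum $[0,\infty)$ and finitely many simple negative eigenvalues; $\sigma_d$ denotes the set of these negative eigenvalues, and $n_-(A)$ the number of negative eigenvalues of $A$ counted with multiplicity. Eigenvalues (all simple, listed in increasing order) of $f\mapsto -f''+qf$ on $L^2(0,1)$: - $\mu_1<\mu_2<\dots$ for $f(0)=f(1)=0$; - $\nu_0<\nu_1<\dots$ for $f'(0)=f'(1)=0$; - $\tau_1<\tau_2<\dots$ for $f(0)=f'(1)=0$; - $\varrho_1<\varrho_2<\dots$ for $f'(0)=f(1)=0$. The case distinction on the sign of $\tau_N$ is for $N\ge 1$. *)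

(* Defs.v *)
From HB Require Import structures.
From mathcomp Require Import all_boot all_order all_algebra.
From mathcomp Require Import all_classical all_reals all_analysis.
From mathcomp Require Import complex.
Set Implicit Arguments.
Unset Strict Implicit.
Unset Printing Implicit Defensive.
Import Order.TTheory GRing.Theory Num.Theory.
Import numFieldNormedType.Exports.
Local Open Scope classical_set_scope.
Local Open Scope complex_scope.
Local Open Scope ring_scope.

(* Elements of L^2(I) are represented by complex-valued functions on the whole
   line: values off I are irrelevant, and equality in L^2(I) is equality almost
   everywhere on I. *)

Section ComplexFunctions.
Context {R : realType}.
Local Notation mu := (@lebesgue_measure R).

Definition ae_eq_on (I : set R) (f g : R -> R[i]) : Prop :=
  {ae mu, forall x, I x -> f x = g x}.

Definition cintegrable (I : set R) (f : R -> R[i]) : Prop :=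
  mu.-integrable I (EFin \o (fun x => complex.Re (f x))) /\
  mu.-integrable I (EFin \o (fun x => complex.Im (f x))).

Definition cintegral (I : set R) (f : R -> R[i]) : R[i] :=
  (\int[mu]_(x in I) complex.Re (f x)) +i* (\int[mu]_(x in I) complex.Im (f x)).

Definition sq_integrable (I : set R) (f : R -> R[i]) : Prop :=
  [/\ measurable_fun I (fun x => complex.Re (f x)),
      measurable_fun I (fun x => complex.Im (f x)) &
      mu.-integrable I (EFin \o (fun x => complex.Re (f x) ^+ 2 + complex.Im (f x) ^+ 2))].

(* On an interval I: f is absolutely continuous on every compact [a, b] in I,
   with almost everywhere derivative g.  If g is continuous then g is the
   derivative of f everywhere on I, one-sided at an end point. *)
Definition ac_deriv (I : set R) (f g : R -> R[i]) : Prop :=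
  forall a b : R, I a -> I b -> a <= b ->
    cintegrable `[a, b] g /\ f b - f a = cintegral `[a, b] g.

End ComplexFunctions.

(* An unbounded operator in L^2(carrier), given by its graph:
   [graph A f g] means that f is in the domain of A and A f = g. *)
Record operator (R : realType) := Operator {
  carrier : set R ;
  graph : (R -> R[i]) -> (R -> R[i]) -> Prop }.

Section Schroedinger.
Context {R : realType}.

(* f |-> - f'' + p f in L^2(I) on its maximal domain, restricted by the boundary
   condition bc on f and f'. *)
Definition schroedinger (I : set R)
    (bc : (R -> R[i]) -> (R -> R[i]) -> Prop) (p : R -> R) : operator R :=
  @Operator R I (fun f g =>
    [/\ sq_integrable I f, sq_integrable I g &
        exists f1 f2 : R -> R[i],
          [/\ ac_deriv I f f1, ac_deriv I f1 f2, bc f f1 &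
              ae_eq_on I g (fun x => - f2 x + (p x)%:C * f x)]]).

Definition zero_ext (q : R -> R) : R -> R :=
  fun x => if 0 < x < 1 then q x else 0.

Definition T_D (q : R -> R) : operator R :=
  schroedinger `[0, +oo[ (fun f _ => f 0 = 0) (zero_ext q).

Definition T_N (q : R -> R) : operator R :=
  schroedinger `[0, +oo[ (fun _ f1 => f1 0 = 0) (zero_ext q).

Definition T_even (q : R -> R) : operator R :=
  schroedinger setT (fun _ _ => True) (fun x => zero_ext q `|x|).

Definition L_DD (q : R -> R) : operator R :=
  schroedinger `[0, 1] (fun f _ => f 0 = 0 /\ f 1 = 0) q.

Definition L_NN (q : R -> R) : operator R :=
  schroedinger `[0, 1] (fun _ f1 => f1 0 = 0 /\ f1 1 = 0) q.

Definition L_DN (q : R -> R) : operator R :=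
  schroedinger `[0, 1] (fun f f1 => f 0 = 0 /\ f1 1 = 0) q.

Definition L_ND (q : R -> R) : operator R :=
  schroedinger `[0, 1] (fun f f1 => f1 0 = 0 /\ f 1 = 0) q.

End Schroedinger.

Section Spectrum.
Context {R : realType}.
Implicit Types (A : operator R) (l : R).

Definition eigenspace A l : set (R -> R[i]) :=
  [set f | graph A f (fun x => l%:C * f x)].

Definition eigenvalue A l : Prop :=
  exists2 f, eigenspace A l f & ~ ae_eq_on (carrier A) f (fun=> 0).

(* linear independence over the complex numbers, in L^2(carrier A) *)
Definition lin_indep A (k : nat) (e : 'I_k -> R -> R[i]) : Prop :=
  forall c : 'I_k -> R[i],
    ae_eq_on (carrier A) (fun x => \sum_(i < k) c i * e i x) (fun=> 0) ->
    forall i, c i = 0.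

(* the dimension of the eigenspace, possibly infinite *)
Definition multiplicity A l : \bar R :=
  ereal_sup [set (k%:R)%:E | k in [set k : nat |
    exists2 e : 'I_k -> R -> R[i],
      (forall i, eigenspace A l (e i)) & lin_indep A e]].

Definition sigma_d A : set R := [set l | l < 0 /\ eigenvalue A l].

Definition n_minus A : \bar R := \esum_(l in sigma_d A) multiplicity A l.

(* u k0 < u k0.+1 < ... are exactly the eigenvalues of A *)
Definition eigenvalue_sequence A (k0 : nat) (u : nat -> R) : Prop :=
  (forall i j : nat, (k0 <= i)%N -> (i < j)%N -> u i < u j) /\
  [set l | eigenvalue A l] = [set u j | j in [set j | (k0 <= j)%N]].

(* E 1 < ... < E n are exactly the negative eigenvalues of A *)
Definition negative_eigenvalues A (n : nat) (E : nat -> R) : Prop :=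
  (forall i j : nat, (1 <= i)%N -> (i < j)%N -> (j <= n)%N -> E i < E j) /\
  sigma_d A = [set E j | j in [set j | (1 <= j <= n)%N]].

End Spectrum.

(* Main.v *)
Require Import Defs.
From mathcomp Require Import all_boot all_order all_algebra.
From mathcomp Require Import all_classical all_reals all_analysis.
From mathcomp Require Import complex measurable_realfun zify lra ring.
Set Implicit Arguments.
Unset Strict Implicit.
Unset Printing Implicit Defensive.
Import Order.TTheory GRing.Theory Num.Theory.
Import numFieldNormedType.Exports.
Local Open Scope classical_set_scope.
Local Open Scope ring_scope.

(* With [Q' = q], the quasi-derivative [w = f' - Q f] turns [- f'' + q f = l f] into a linear
   system with continuous coefficients.  Let [U l] and [V l] be the values at [1] of [f] and [f']
   for the solution with [f 0 = 0] or with [f' 0 = 0].  Eigenvalues on [[0, 1]] are zeros of [U] or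
   [V]; since a square integrable solution decays like [exp (- sqrt (- l) x)] beyond [1], negative
   eigenvalues on the half-line are zeros of [F l = V l + sqrt (- l) U l]; and even and odd parts
   reduce the line to the two half-lines.  The Wronskian of the solutions for [l] and [m] shows
   that the vector [(U, V)] turns in a fixed direction as [l] grows.  Hence each of the products
   [V F], [F U] and [F_N F_D], which are positive near minus infinity, changes sign from plus to
   minus at the zeros of one factor and back at the zeros of the other, so that the zeros of the
   two factors alternate. *)

(** * Sign changes and counting *)

(** As [q] is only integrable, [f'] is merely absolutely continuous. In terms of [(f, w)] the
    potential disappears, and solutions are differentiable at every [x > 0], so that mean value
    arguments apply. [Q] is constant outside [[0, 1]], hence bounded on the line.

    No smoothness in the spectral parameter is established either. A Lipschitz bound in [l] turns
    the Wronskian identity into a strict inequality on a punctured neighbourhood of each point, and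
    alternation uses only sign changes in this weak sense. A zero between two points of opposite
    sign is found as a supremum; its kind is known because it must belong to one of the factors.

    The condition on [tau N] comes from the upper end [l = 0]. There [sqrt (- l)] vanishes and [F]
    equals [V], so that [V F] is positive just left of [0] and each negative zero of [V] is followed
    by a negative zero of [F]. In the Dirichlet case this says that [m] is the number of negative
    terms of [tau], while alternation of the zeros of [F_N] and [F_D] leaves only [m = N] and
    [m = N - 1]. *)

Section Crossings.
Context {R : realType}.
Implicit Types (h : R -> R) (z : R).

(** [s = 1] is a change from minus to plus, [s = -1] one from plus to minus. Only signs on a
    punctured neighbourhood enter, which covers zeros of any order and functions without a
    derivative. *)
Definition crossing (s : R) h z :=
  exists2 e, 0 < e & forall x, 0 < `|x - z| < e -> 0 < s * (x - z) * h x.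

Lemma continuous_pos_near h z : continuous h -> 0 < h z ->
  exists2 e, 0 < e & forall x, `|x - z| < e -> 0 < h x.
Proof.
move=> hc hz; have /cvgrPdist_lt/(_ _ hz) := hc z.
move=> /nbhs_ballP[e /= e0 he]; exists e => // x xz.
have := he x; rewrite /ball/= distrC => /(_ xz).
by rewrite ltr_distlC => /andP[]; rewrite subrr.
Qed.

(** The zero is the supremum of the points of [[x0, x1]] where [h] is negative. Such points
    accumulate at it from the left, which excludes a change from plus to minus. The negated form
    suffices, because every zero met later is of one of the two types. *)
Lemma upcrossing_between h x0 x1 : continuous h ->
  x0 < x1 -> h x0 < 0 -> 0 < h x1 ->
  exists z, [/\ x0 < z, z < x1, h z = 0 & ~ crossing (-1) h z].
Proof.
move=> hc x01 h0 h1.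
pose A := [set x | x0 <= x <= x1 /\ h x < 0].
have Ax0 : A x0 by rewrite /A/= lexx ltW.
have supA : has_sup A.
  by split; [exists x0|exists x1 => x [/andP[]]].
have x0s : x0 <= sup A by exact: ub_le_sup (proj2 supA) _ Ax0.
have sx1 : sup A <= x1 by apply: ge_sup; [exists x0|move=> x [/andP[]]].
have hNc : continuous (fun x => - h x) by move=> x; apply: continuousN; exact: hc.
have hs : h (sup A) = 0.
  apply/eqP; case: ltgtP => // hs.
    have [e e0 he] : exists2 e, 0 < e & forall x, `|x - sup A| < e -> 0 < - h x.
      by apply: continuous_pos_near; rewrite ?oppr_gt0.
    have sx1' : sup A < x1.
      rewrite lt_neqAle sx1 andbT; apply/eqP => E.
      by move: hs; rewrite E ltNge (ltW h1).
    pose y := Num.min x1 (sup A + e / 2).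
    have sy : sup A < y by rewrite lt_min sx1' ltrDl divr_gt0.
    have yle : y <= sup A + e / 2 by rewrite ge_min lexx orbT.
    have : A y.
      split; first by rewrite (le_trans x0s (ltW sy)) ge_min lexx.
      by rewrite -oppr_gt0 he// gtr0_norm ?subr_gt0//; lra.
    by move=> /(ub_le_sup (proj2 supA)); rewrite leNgt sy.
  have [e e0 he] := continuous_pos_near hc hs.
  have [y Ay /= ylt] := sup_adherent e0 supA.
  have ys := ub_le_sup (proj2 supA) Ay.
  have hy : h y < 0 by case: Ay.
  have : 0 < h y by apply: he; rewrite ler0_norm ?subr_le0//; lra.
  by rewrite ltNge (ltW hy).
exists (sup A); split=> //.
- by rewrite lt_neqAle x0s andbT; apply/eqP => E; move: h0; rewrite E hs ltxx.
- by rewrite lt_neqAle sx1 andbT; apply/eqP => E; move: h1; rewrite -E hs ltxx.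
- case=> e e0 he; have [y Ay /= ylt] := sup_adherent e0 supA.
  have ys := ub_le_sup (proj2 supA) Ay.
  have hy : h y < 0 by case: Ay.
  have ys' : y < sup A.
    by rewrite lt_neqAle ys andbT; apply/eqP => E; move: hy; rewrite E hs ltxx.
  have := he y; rewrite ltr0_norm ?subr_lt0//.
  have -> : 0 < - (y - sup A) < e by apply/andP; split; lra.
  move=> /(_ isT); rewrite mulN1r => hy'.
  by have := pmulr_rgt0 (h y) (_ : 0 < - (y - sup A)); rewrite hy' => /(_ ltac:(lra)); lra.
Qed.

Lemma downcrossing_between h x0 x1 : continuous h ->
  x0 < x1 -> 0 < h x0 -> h x1 < 0 ->
  exists z, [/\ x0 < z, z < x1, h z = 0 & ~ crossing 1 h z].
Proof.
move=> hc x01 h0 h1.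
have hNc : continuous (fun x => - h x) by move=> x; apply: continuousN; exact: hc.
have [||z [xz zx /eqP hz nc]] := upcrossing_between hNc x01; rewrite ?oppr_lt0 ?oppr_gt0//.
exists z; split=> //; first by apply/eqP; rewrite -oppr_eq0.
by move=> [e e0 he]; apply: nc; exists e => // x /he; rewrite mulrN !mulNr opprK.
Qed.

Lemma crossing_near_left s h z b : crossing s h z -> b < z ->
  exists x, [/\ b < x, x < z & s * h x < 0].
Proof.
case=> e e0 he bz; pose x := z - Num.min (z - b) e / 2.
have m0 : 0 < Num.min (z - b) e by rewrite lt_min e0 subr_gt0 bz.
have m1 : Num.min (z - b) e <= z - b by rewrite ge_min lexx.
have m2 : Num.min (z - b) e <= e by rewrite ge_min lexx orbT.
exists x; split; [rewrite /x; lra|rewrite /x; lra|].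
have xz : x - z < 0 by rewrite /x; lra.
have := he x; rewrite ltr0_norm//; have -> : 0 < - (x - z) < e.
  by rewrite /x; apply/andP; split; lra.
by move=> /(_ isT); rewrite mulrAC nmulr_lgt0.
Qed.

Lemma crossing_near_right s h z b : crossing s h z -> z < b ->
  exists x, [/\ z < x, x < b & 0 < s * h x].
Proof.
case=> e e0 he bz; pose x := z + Num.min (b - z) e / 2.
have m0 : 0 < Num.min (b - z) e by rewrite lt_min e0 subr_gt0 bz.
have m1 : Num.min (b - z) e <= b - z by rewrite ge_min lexx.
have m2 : Num.min (b - z) e <= e by rewrite ge_min lexx orbT.
exists x; split; [rewrite /x; lra|rewrite /x; lra|].
have xz : 0 < x - z by rewrite /x; lra.
have := he x; rewrite gtr0_norm//; have -> : 0 < x - z < e.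
  by rewrite /x; apply/andP; split; lra.
by move=> /(_ isT); rewrite mulrAC pmulr_lgt0.
Qed.

End Crossings.

Section Alternation.
Context {R : realType}.
Variables (h : R -> R) (Zf Zg : set R) (l0 : R).

(* [h] is to be a product [f * g]; [Zf] and [Zg] are the negative zeros of [f] and of [g]. *)
Record alternating : Prop := Alternating {
  alt_cont : continuous h;
  alt_neg : forall z, (Zf `|` Zg) z -> z < 0;
  alt_zero : forall z, z < 0 -> h z = 0 -> (Zf `|` Zg) z;
  alt_down : forall z, Zf z -> crossing (-1) h z;
  alt_up : forall z, Zg z -> crossing 1 h z;
  alt_pos : forall x, x <= l0 -> 0 < h x }.

Hypothesis alt : alternating.

(** [h] is positive far to the left and negative just before a rise; a zero in between that is not a
    rise must lie in [Zf]. The next three lemmas follow the same scheme with other sources for the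
    two signs. *)
Lemma alternating_first z : Zg z -> exists2 y, Zf y & y < z.
Proof.
move=> gz; have z0 : z < 0 by apply: (alt_neg alt); right.
pose b := Num.min l0 (z - 1).
have bz : b < z by rewrite gt_min; apply/orP; right; lra.
have [x [bx xz]] := crossing_near_left (alt_up alt gz) bz; rewrite mul1r => hx.
have hb : 0 < h b by apply: (alt_pos alt); rewrite ge_min lexx.
have [y [by_ yx hy nc]] := downcrossing_between (alt_cont alt) bx hb hx.
exists y; last exact: lt_trans xz.
have [//|/(alt_up alt)//] := alt_zero alt (lt_trans (lt_trans yx xz) z0) hy.
Qed.

Lemma alternating_gg z z' : Zg z -> Zg z' -> z < z' ->
  exists y, [/\ Zf y, z < y & y < z'].
Proof.
move=> gz gz' zz'; have z0 : z' < 0 by apply: (alt_neg alt); right.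
have [x [zx xz']] := crossing_near_right (alt_up alt gz) zz'; rewrite mul1r => hx.
have [x' [xx' x'z']] := crossing_near_left (alt_up alt gz') xz'; rewrite mul1r => hx'.
have [y [xy yx' hy nc]] := downcrossing_between (alt_cont alt) xx' hx hx'.
exists y; split; [|exact: lt_trans xy|exact: lt_trans x'z'].
have [//|/(alt_up alt)//] := alt_zero alt (lt_trans (lt_trans yx' x'z') z0) hy.
Qed.

Lemma alternating_ff z z' : Zf z -> Zf z' -> z < z' ->
  exists y, [/\ Zg y, z < y & y < z'].
Proof.
move=> fz fz' zz'; have z0 : z' < 0 by apply: (alt_neg alt); left.
have [x [zx xz']] := crossing_near_right (alt_down alt fz) zz'; rewrite mulN1r oppr_gt0 => hx.
have [x' [xx' x'z']] := crossing_near_left (alt_down alt fz') xz'; rewrite mulN1r oppr_lt0 => hx'.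
have [y [xy yx' hy nc]] := upcrossing_between (alt_cont alt) xx' hx hx'.
exists y; split; [|exact: lt_trans xy|exact: lt_trans x'z'].
have [/(alt_down alt)//|//] := alt_zero alt (lt_trans (lt_trans yx' x'z') z0) hy.
Qed.

(** After a fall [h] is negative, and positivity just left of [0] forces it to rise once more. *)
Lemma alternating_last z e : 0 < e -> (forall x, - e < x -> x < 0 -> 0 < h x) ->
  Zf z -> exists2 y, Zg y & z < y.
Proof.
move=> e0 he fz; have z0 : z < 0 by apply: (alt_neg alt); left.
have [x [zx xz']] := crossing_near_right (alt_down alt fz) z0; rewrite mulN1r oppr_gt0 => hx.
pose b := Num.max (x / 2) (- e / 2).
have b0 : b < 0 by rewrite gt_max; apply/andP; split; lra.
have xb : x < b by rewrite lt_max; apply/orP; left; lra.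
have hb : 0 < h b by apply: he => //; rewrite lt_max; apply/orP; right; lra.
have [y [xy yb hy nc]] := upcrossing_between (alt_cont alt) xb hx hb.
exists y; last exact: lt_trans xy.
have [/(alt_down alt)//|//] := alt_zero alt (lt_trans yb b0) hy.
Qed.

End Alternation.

Section Counting.
Context {R : realType}.

(** The index set is an initial segment of the naturals, given as a set. A finite list of
    eigenvalues and the negative terms of an infinite sequence are thus treated alike, both numbered
    from [0]. *)
Record enumerates (Z : set R) (D : set nat) (u : nat -> R) : Prop := Enumerates {
  enum_down : forall i j, (i <= j)%N -> D j -> D i;
  enum_lt : forall i j, D j -> (i < j)%N -> u i < u j;
  enum_im : Z = u @` D }.

Lemma enum_in Z D u j : enumerates Z D u -> D j -> Z (u j).
Proof. by move=> e Dj; rewrite (enum_im e); exists j. Qed.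

Lemma enum_lt_index Z D u i j : enumerates Z D u -> D i -> D j ->
  u i < u j -> (i < j)%N.
Proof.
move=> e Di Dj; apply: contraTT; rewrite -leqNgt -leNgt leq_eqVlt.
by move=> /predU1P[->//|/(enum_lt e Di)/ltW].
Qed.

Lemma enum_succ Z D u j z : enumerates Z D u -> D j -> Z z -> u j < z ->
  D j.+1 /\ u j.+1 <= z.
Proof.
move=> e Dj; rewrite {1}(enum_im e) => -[k Dk <-] jk.
have {}jk := enum_lt_index e Dj Dk jk; split; first exact: (enum_down e) Dk.
by move: jk; rewrite leq_eqVlt => /predU1P[->//|/(enum_lt e Dk)/ltW].
Qed.

Lemma enum_first Z D u z : enumerates Z D u -> Z z -> D 0%N /\ u 0%N <= z.
Proof.
move=> e; rewrite {1}(enum_im e) => -[k Dk <-]; split; first exact: (enum_down e) Dk.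
by case: k Dk => [//|k Dk]; apply/ltW/(enum_lt e Dk).
Qed.

Variables (h : R -> R) (Zf Zg : set R) (l0 : R) (Df Dg : set nat) (u v : nat -> R).
Hypothesis alt : alternating h Zf Zg l0.
Hypotheses (eu : enumerates Zf Df u) (ev : enumerates Zg Dg v).

(** Between [v j] and [v j.+1] lies some [y] in [Zf]; as [u j < v j < y], the next term of [u]
    exists and is at most [y]. *)
Lemma alternating_lt j : Dg j -> Df j /\ u j < v j.
Proof.
elim: j => [|j IH] Dj.
  have [y fy yv] := alternating_first alt (enum_in ev Dj).
  have [D0 u0] := enum_first eu fy; split=> //; exact: le_lt_trans yv.
have [Dfj uv] := IH (enum_down ev (leqnSn j) Dj).
have [y [fy vy yv]] := alternating_gg alt
  (enum_in ev (enum_down ev (leqnSn j) Dj)) (enum_in ev Dj) (enum_lt ev Dj (ltnSn j)).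
have [D' le'] := enum_succ eu Dfj fy (lt_trans uv vy).
by split=> //; exact: le_lt_trans yv.
Qed.

Lemma alternating_ltS j : Df j.+1 -> Dg j /\ v j < u j.+1.
Proof.
elim: j => [|j IH] Dj.
  have D0 := enum_down eu (leqnSn 0) Dj.
  have [y [gy _ yu]] := alternating_ff alt (enum_in eu D0) (enum_in eu Dj) (enum_lt eu Dj (ltnSn 0)).
  have [D0' v0] := enum_first ev gy; split=> //; exact: le_lt_trans yu.
have Dj' := enum_down eu (leqnSn j.+1) Dj.
have [Dgj vu] := IH Dj'.
have [y [gy uy yu]] := alternating_ff alt (enum_in eu Dj') (enum_in eu Dj) (enum_lt eu Dj (ltnSn j.+1)).
have [D' le'] := enum_succ ev Dgj gy (lt_trans vu uy).
by split=> //; exact: le_lt_trans yu.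
Qed.

(** Together with [alternating_lt] this makes the two kinds of zeros equally numerous. *)
Lemma alternating_card e : 0 < e -> (forall x, - e < x -> x < 0 -> 0 < h x) ->
  forall j, Df j -> Dg j.
Proof.
move=> e0 he [|j] Dj; have [y gy uy] := alternating_last alt e0 he (enum_in eu Dj).
  by have [] := enum_first ev gy.
have [Dgj vu] := alternating_ltS Dj.
by have [] := enum_succ ev Dgj gy (lt_trans vu uy).
Qed.

End Counting.

Section Parity.
Context {R : realType}.
Variables (h : R -> R) (Zf Zg : set R) (l0 : R) (D : set nat) (E : nat -> R).
Hypothesis alt : alternating h Zf Zg l0.
Hypothesis eE : enumerates (Zf `|` Zg) D E.

(** A fall and a rise at the same point prescribe opposite signs just to the right of it. *)
Lemma alternating_disjoint z : Zf z -> Zg z -> False.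
Proof.
move=> fz gz; have z0 : z < 0 by apply: (alt_neg alt); left.
have [e e0 he] := alt_down alt fz; have [e' e'0 he'] := alt_up alt gz.
pose d := Num.min e e' / 2.
have m0 : 0 < Num.min e e' by rewrite lt_min e0.
have m1 : Num.min e e' <= e by rewrite ge_min lexx.
have m2 : Num.min e e' <= e' by rewrite ge_min lexx orbT.
have dz : `|z + d - z| = d by rewrite addrAC subrr add0r gtr0_norm // /d; lra.
have d0 : 0 < d by rewrite /d; lra.
have := he' (z + d); have := he (z + d); rewrite dz.
have -> : 0 < d < e by rewrite d0 /d; lra.
have -> : 0 < d < e' by rewrite d0 /d; lra.
move=> /(_ isT) + /(_ isT); rewrite mul1r mulN1r mulNr oppr_gt0 => h1.
by rewrite ltNge (ltW h1).
Qed.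

(** Two consecutive terms of the merged list cannot be of the same kind, since a zero of the other
    kind would lie between them; the first term is in [Zf] by [alternating_first]. *)
Lemma alternating_parity j : D j -> if odd j then Zg (E j) else Zf (E j).
Proof.
elim: j => [|j IH] Dj.
  have [//|/(alternating_first alt)[y fy]] := enum_in eE Dj.
  by have [_ y0] := enum_first eE (or_introl fy); rewrite ltNge y0.
have Dj' := enum_down eE (leqnSn j) Dj.
have nobetween y : (Zf `|` Zg) y -> E j < y -> y < E j.+1 -> False.
  by move=> Zy jy; have [_ ] := enum_succ eE Dj' Zy jy; case: ltgtP.
have lt := enum_lt eE Dj (ltnSn j).
have := IH Dj'; rewrite /=; case: (odd j) => /= Zj.
  have [//|gj] := enum_in eE Dj.
  by have [y [fy + yj]] := alternating_gg alt Zj gj lt => /nobetween; case; [left|].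
have [fj|//] := enum_in eE Dj.
by have [y [gy + yj]] := alternating_ff alt Zj fj lt => /nobetween; case; [right|].
Qed.

Lemma enumerates_even : enumerates Zf [set j | D j.*2] (fun j => E j.*2).
Proof.
split.
- by move=> i j ij /= Dj; apply: (enum_down eE) Dj; rewrite leq_double.
- by move=> i j /= Dj ij; apply: (enum_lt eE) => //; rewrite ltn_double.
- apply/seteqP; split=> [z fz|_ [j /= Dj <-]]; last first.
    by have := alternating_parity Dj; rewrite odd_double.
  have : (Zf `|` Zg) z by left.
  rewrite {1}(enum_im eE) => -[k Dk kz].
  have := alternating_parity Dk; rewrite kz.
  have := odd_double_half k; case: (odd k) => /= Ek Zk.
    by case: (alternating_disjoint fz Zk).
  by exists k./2 => /=; rewrite -Ek add0n doubleK in Dk kz *.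
Qed.

Lemma enumerates_odd : enumerates Zg [set j | D j.*2.+1] (fun j => E j.*2.+1).
Proof.
split.
- by move=> i j ij /= Dj; apply: (enum_down eE) Dj; rewrite ltnS leq_double.
- by move=> i j /= Dj ij; apply: (enum_lt eE) => //; rewrite ltnS ltn_double.
- apply/seteqP; split=> [z gz|_ [j /= Dj <-]]; last first.
    by have := alternating_parity Dj; rewrite /= odd_double.
  have : (Zf `|` Zg) z by right.
  rewrite {1}(enum_im eE) => -[k Dk kz].
  have := alternating_parity Dk; rewrite kz.
  have := odd_double_half k; case: (odd k) => /= Ek Zk; last first.
    by case: (alternating_disjoint Zk gz).
  by exists k./2 => /=; rewrite -[_.+1]add1n Ek.
Qed.

End Parity.

(** * Primitives of integrable functions *)

Section Primitives.
Context {R : realType}.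
Local Notation mu := (@lebesgue_measure R).
Implicit Types (f g p u v : R -> R) (a b c x : R) (I : set R).

(** The real-valued counterpart of [ac_deriv]. *)
Definition primitive_on I f g := forall a b, I a -> I b -> a <= b ->
  mu.-integrable `[a, b] (EFin \o g) /\ f b - f a = \int[mu]_(x in `[a, b]) g x.

Lemma Rintegral_split g a b c : a <= b -> b <= c ->
  mu.-integrable `[a, c] (EFin \o g) ->
  \int[mu]_(x in `[a, c]) g x =
  \int[mu]_(x in `[a, b]) g x + \int[mu]_(x in `[b, c]) g x.
Proof.
move=> ab bc ig; apply/eqP; rewrite addrC -subr_eq; apply/eqP.
rewrite Rintegral_itvB//= Rintegral_itv_obnd_cbnd//.
apply: integrableS ig => //; apply: subset_itv; rewrite bnd_simp//.
Qed.

Lemma integrable_subitv g a b a' b' : a <= a' -> b' <= b ->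
  mu.-integrable `[a, b] (EFin \o g) -> mu.-integrable `[a', b'] (EFin \o g).
Proof.
by move=> aa' bb'; apply: integrableS => //; apply: subset_itv; rewrite bnd_simp.
Qed.

Lemma primitive_onS I I' f g : I `<=` I' -> primitive_on I' f g -> primitive_on I f g.
Proof. by move=> II' H a b /II' Ia /II' Ib; exact: H. Qed.

Lemma primitive_on_eq I f g g' : primitive_on I f g ->
  (forall x, I x -> g x = g' x) ->
  (forall a b x, I a -> I b -> a <= x <= b -> I x) -> primitive_on I f g'.
Proof.
move=> H E conv a b Ia Ib ab; have [ig ->] := H a b Ia Ib ab.
have E' x : x \in `[a, b] -> g x = g' x.
  by rewrite in_itv/= => xab; apply/E/(conv _ _ _ Ia Ib).
split; first by apply: eq_integrable ig => //= x /set_mem/= /E' ->.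
by apply: eq_Rintegral => x /set_mem/E'.
Qed.

Lemma primitive_on_lin I f g f' g' r s : primitive_on I f g -> primitive_on I f' g' ->
  primitive_on I (fun x => r * f x + s * f' x) (fun x => r * g x + s * g' x).
Proof.
move=> H H' a b Ia Ib ab; have [ig e] := H a b Ia Ib ab.
have [ig' e'] := H' a b Ia Ib ab.
have irg : mu.-integrable `[a, b] (EFin \o (fun x => r * g x)).
  by apply: eq_integrable (integrableZl _ r ig) => // x _ /=; rewrite EFinM.
have isg : mu.-integrable `[a, b] (EFin \o (fun x => s * g' x)).
  by apply: eq_integrable (integrableZl _ s ig') => // x _ /=; rewrite EFinM.
split; first by apply: eq_integrable (integrableD _ irg isg).
rewrite RintegralD// !RintegralZl//; move: e e' => <- <-; ring.
Qed.

(** [x] may lie left of [a], where the interval is empty. Cutting [g] off left of [a] and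
    integrating from a point [m] left of both makes [x] an interior point of [[m, x + 1]], on which
    the integral is continuous. *)
Lemma continuous_Rintegral g : (forall a b, mu.-integrable `[a, b] (EFin \o g)) ->
  forall a, continuous (fun x => \int[mu]_(t in `[a, x]) g t).
Proof.
move=> ig a x; pose m := Num.min a x - 1.
have ma : m < a by rewrite ltrBlDr gt_min ltrDl ltr01.
have mx : m < x by rewrite ltrBlDr gt_min ltrDl ltr01 orbT.
pose g' := g \_ `[a, +oo[.
have ig' c : mu.-integrable `[m, c] (EFin \o g').
  rewrite -restrict_EFin; apply/integrable_restrict => //=.
  by apply: integrableS (ig m c) => //; exact: measurableI.
have eg : (fun x => \int[mu]_(t in `[a, x]) g t) = (fun x => \int[mu]_(t in `[m, x]) g' t).
  apply/funext => y; rewrite -Rintegral_mkcondr; congr (\int[mu]_(_ in _) _).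
  apply/seteqP; split=> t /=; rewrite !in_itv/= andbT.
    by move=> /andP[at_ ty]; rewrite at_ ty (le_trans (ltW ma)).
  by move=> [/andP[_ ->]] ->.
rewrite eg.
have mx1 : m < x + 1 by rewrite ltr_wpDr.
have := parameterized_integral_continuous (ltW mx1) (ig' (x + 1)).
move/(continuous_within_itvP _ mx1) => -[+ _ _].
by apply; rewrite in_itv/= mx ltrDl ltr01.
Qed.

Lemma primitive_on_within a b f g : a < b ->
  primitive_on `[a, b] f g -> {within `[a, b], continuous f}.
Proof.
move=> ab H; have aab : `[a, b]%classic a by rewrite /= in_itv/= lexx ltW.
have [|ig _] := H a b aab _ (ltW ab); first by rewrite /= in_itv/= lexx ltW.
have := parameterized_integral_continuous (ltW ab) ig.
move=> /(@within_continuousD _ _ _ _ (cst (f a)) _ _) c.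
apply: subspace_eq_continuous (c _); last by move=> x; exact: cst_continuous.
move=> x /set_mem xab; have [] := H a x aab xab _.
  by move: xab; rewrite /= in_itv/= => /andP[].
by move=> _ E; rewrite -[RHS](subrKC (f a)) E.
Qed.

Lemma primitive_on_continuous f g : primitive_on setT f g -> continuous f.
Proof.
move=> H x; have : x - 1 < x + 1 by lra.
move=> lt; have : {within `[x - 1, x + 1], continuous f}.
  by apply: primitive_on_within lt _; exact: primitive_onS H.
move=> /(continuous_within_itvP _ lt)[+ _ _]; apply.
by rewrite in_itv/=; apply/andP; split; lra.
Qed.

Lemma primitive_on_setT g : mu.-integrable setT (EFin \o g) ->
  primitive_on setT (fun x => \int[mu]_(t in `]-oo, x]) g t) g.
Proof.
move=> ig a b _ _ ab; split; first exact: integrableS ig.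
rewrite Rintegral_itvB//; [|exact: integrableS ig].
by rewrite Rintegral_itv_obnd_cbnd//; exact: integrableS ig.
Qed.

Lemma le_normr_Rintegral_setT g (D : set (measurableTypeR R)) : measurable D ->
  mu.-integrable setT (EFin \o g) ->
  `|\int[mu]_(t in D) g t| <= \int[mu]_t `|g t|.
Proof.
move=> mD ig; have igD : mu.-integrable D (EFin \o g) by exact: integrableS ig.
apply: (le_trans (le_normr_Rintegral mD igD)).
rewrite /Rintegral fine_le//.
- by apply: integrable_fin_num => //; exact: integrable_norm igD.
- by apply: integrable_fin_num => //; exact: integrable_norm ig.
- apply: ge0_subset_integral => //=.
  have := measurable_int _ ig => /measurable_EFinP mg.
  by apply/measurable_EFinP; exact: measurableT_comp.
Qed.

End Primitives.

(** * Integration by parts for absolutely continuous functions *)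

Section ByParts.
Context {R : realType}.
Local Notation mu := (@lebesgue_measure R).
Implicit Types (p v P U : R -> R) (a b : R).

Lemma EFin_Rintegral (D : set (measurableTypeR R)) g : measurable D -> mu.-integrable D (EFin \o g) ->
  (\int[mu]_(x in D) (g x)%:E)%E = (\int[mu]_(x in D) g x)%:E.
Proof. by move=> mD ig; rewrite fineK//; exact: integrable_fin_num ig. Qed.

(** Both sides are iterated integrals of [p t * v s] over the half-plane [s <= t], so this is
    Fubini's theorem; the product of the two [L^1] norms dominates. *)
Lemma Rintegral_exchange p v :
  mu.-integrable setT (EFin \o p) -> mu.-integrable setT (EFin \o v) ->
  (\int[mu]_t (p t * \int[mu]_(s in `]-oo, t]) v s)%:E =
  \int[mu]_s (v s * \int[mu]_(t in `[s, +oo[) p t)%:E)%E.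
Proof.
move=> ip iv.
have /measurable_EFinP mp := measurable_int _ ip.
have /measurable_EFinP mv := measurable_int _ iv.
pose S := [set z : measurableTypeR R * measurableTypeR R | z.2 <= z.1].
pose F (z : measurableTypeR R * measurableTypeR R) : \bar R := (p z.1 * v z.2 * \1_S z)%:E.
have mF : measurable_fun setT F.
  apply/measurable_EFinP; apply: measurable_funM.
    apply: measurable_funM.
      by apply: (measurableT_comp mp); exact: measurable_fst.
    by apply: (measurableT_comp mv); exact: measurable_snd.
  apply: measurable_indic.
  rewrite -[S]setTI.
  apply: (@measurable_fun_le _ _ _ _ (fun z : measurableTypeR R * measurableTypeR R => z.2)
    (fun z => z.1)) => //.
  - exact: (@measurable_snd _ _ (measurableTypeR R) (measurableTypeR R)).
  - exact: (@measurable_fst _ _ (measurableTypeR R) (measurableTypeR R)).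
have Ft t s : F (t, s) = (p t * (v \_ `]-oo, t]) s)%:E.
  rewrite /F /= patchE indicE; congr (_%:E).
  have -> : ((t, s) \in S) = (s \in `]-oo, t]%classic).
    by apply/idP/idP => /set_mem/=; rewrite ?in_itv/= => st; apply/mem_set; rewrite /= ?in_itv.
  by case: ifP; rewrite ?mulr1 ?mulr0.
have Fs t s : F (t, s) = (v s * (p \_ `[s, +oo[) t)%:E.
  rewrite /F /= patchE indicE; congr (_%:E).
  have -> : ((t, s) \in S) = (t \in `[s, +oo[%classic).
    by apply/idP/idP => /set_mem/=; rewrite ?in_itv/= ?andbT => st; apply/mem_set;
      rewrite /= ?in_itv/= ?andbT.
  by case: ifP; rewrite ?mulr1 ?mulr0// mulrC.
have iv' (D : set (measurableTypeR R)) : measurable D -> mu.-integrable setT (EFin \o (v \_ D)).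
  move=> mD; rewrite -restrict_EFin; apply/integrable_restrict => //=.
  by apply: integrableS iv => //; rewrite setTI.
have ip' (D : set (measurableTypeR R)) : measurable D -> mu.-integrable setT (EFin \o (p \_ D)).
  move=> mD; rewrite -restrict_EFin; apply/integrable_restrict => //=.
  by apply: integrableS ip => //; rewrite setTI.
have iF : (mu \x mu)%E.-integrable setT F.
  apply/(integrable12ltyP mu mu mF).
  have ivn := integrable_norm iv; have ipn := integrable_norm ip.
  pose V := \int[mu]_s `|v s|.
  have measFF := measurable_fun_fubini_tonelli_F (m2 := mu) (abse \o F)
    (measurableT_comp (@abse_measurable _ setT) mF) (fun z => abse_ge0 (F z)).
  apply: (@le_lt_trans _ _ (\int[mu]_t (`|p t| * V)%:E)%E).
    apply: ge0_le_integral => //.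
    - by move=> t _; apply: integral_ge0.
    - apply/measurable_EFinP; apply: measurable_funM => //.
      exact: measurableT_comp.
    - move=> t _; rewrite EFinM -EFin_Rintegral// -ge0_integralZl//=.
      + apply: ge0_le_integral => //.
        * apply/measurable_EFinP; apply: measurableT_comp => //.
          rewrite (_ : (fun _ => _) = (fun s => p t * (v \_ `]-oo, t]) s)); last first.
            by apply/funext => s; have [] := Ft t s.
          apply: measurable_funM => //.
          have := measurable_int _ (iv' `]-oo, t]%classic (measurable_itv _)).
          by move=> /measurable_EFinP.
        * by apply/measurable_EFinP; apply: measurable_funM => //; exact: measurableT_comp.
        * move=> s _; have [->] := Ft t s; rewrite lee_fin normrM ler_wpM2l// patchE.
          by case: ifP => // _; rewrite normr0.
      + by apply/measurable_EFinP; exact: measurableT_comp.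
  under eq_integral do rewrite EFinM.
  rewrite ge0_integralZr//=.
  - by rewrite EFin_Rintegral// -EFinM ltry.
  - by apply/measurable_EFinP; exact: measurableT_comp.
  - by rewrite lee_fin Rintegral_ge0.
have := Fubini iF.
under eq_integral => t _.
  under eq_integral => s _ do rewrite Ft EFinM.
  rewrite integralZl//; last exact: iv'.
  rewrite EFin_Rintegral//; last exact: iv'.
  rewrite -Rintegral_mkcond -EFinM; over.
move=> ->; apply: eq_integral => s _.
under eq_integral => t _ do rewrite Fs EFinM.
rewrite integralZl//; last exact: ip'.
by rewrite EFin_Rintegral; [rewrite -Rintegral_mkcond|by []|exact: ip'].
Qed.

Lemma integrable_mul_within p U a b : mu.-integrable `[a, b] (EFin \o p) ->
  {within `[a, b], continuous U} -> mu.-integrable `[a, b] (EFin \o (fun x => p x * U x)).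
Proof.
move=> ip cU.
suff H : mu.-integrable `[a, b] ((EFin \o p) \* (EFin \o U))%E.
  by apply: eq_integrable H => // x _ /=.
apply: integrableMl => //.
- exact: subspace_continuous_measurable_fun.
- have : compact (U @` `[a, b]) by apply: continuous_compact => //; exact: segment_compact.
  move=> /compact_bounded[M [_ mrt]]; exists M; split; rewrite ?num_real//.
  by move=> N MN x abx; apply: mrt MN _ _; exists x.
Qed.

(** Write [U t - U a] as the integral of [v] over [[a, t]] and [P b - P s] as that of [p] over
    [[s, b]]. The exchange lemma for the restrictions to [[a, b]] equates the integrals of
    [p (U - U a)] and [v (P b - P)], which rearranges to the product formula. *)
Lemma primitive_on_mul_ends p v P U a b : a < b ->
  primitive_on `[a, b] P p -> primitive_on `[a, b] U v ->
  mu.-integrable `[a, b] (EFin \o (fun x => p x * U x + v x * P x)) /\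
  P b * U b - P a * U a = \int[mu]_(x in `[a, b]) (p x * U x + v x * P x).
Proof.
move=> ab HP HU; have cP := primitive_on_within ab HP.
have cU := primitive_on_within ab HU.
have aab : `[a, b]%classic a by rewrite /= in_itv/= lexx ltW.
have bab : `[a, b]%classic b by rewrite /= in_itv/= lexx ltW.
have [ip eP] := HP a b aab bab (ltW ab); have [iv eU] := HU a b aab bab (ltW ab).
have ipU := integrable_mul_within ip cU; have ivP := integrable_mul_within iv cP.
split; first exact: eq_integrable (integrableD _ ipU ivP).
rewrite RintegralD//.
pose p' := p \_ `[a, b]; pose v' := v \_ `[a, b].
have ip' : mu.-integrable setT (EFin \o p').
  by rewrite -restrict_EFin; apply/integrable_restrict => //=; rewrite setTI.
have iv' : mu.-integrable setT (EFin \o v').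
  by rewrite -restrict_EFin; apply/integrable_restrict => //=; rewrite setTI.
have := Rintegral_exchange ip' iv'.
have -> : (fun t => (p' t * \int[mu]_(s in `]-oo, t]) v' s)%:E) =
    (EFin \o (fun t => p t * U t - U a * p t)) \_ `[a, b].
  apply/funext => t; rewrite !patchE /p' patchE; case: ifPn => [/set_mem tab|]; last by rewrite mul0r.
  rewrite -Rintegral_mkcondr /= [U a * _]mulrC -mulrBr; congr ((_ * _)%:E).
  have /andP[at_ tb] : a <= t <= b by move: tab; rewrite /= in_itv.
  have [_ ->] := HU a t aab tab at_; congr (\int[mu]_(_ in _) _).
  apply/seteqP; split=> x /=; rewrite !in_itv/=; first by move=> [-> /andP[->]].
  by move=> /andP[ax xt]; rewrite ax xt (le_trans xt tb).
have -> : (fun s => (v' s * \int[mu]_(t in `[s, +oo[) p' t)%:E) =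
    (EFin \o (fun s => P b * v s - v s * P s)) \_ `[a, b].
  apply/funext => t; rewrite !patchE /v' patchE; case: ifPn => [/set_mem tab|]; last by rewrite mul0r.
  rewrite -Rintegral_mkcondr /= [P b * _]mulrC -mulrBr; congr ((_ * _)%:E).
  have /andP[at_ tb] : a <= t <= b by move: tab; rewrite /= in_itv.
  have [_ ->] := HP t b tab bab tb; congr (\int[mu]_(_ in _) _).
  apply/seteqP; split=> x /=; rewrite !in_itv/= ?andbT; first by move=> [-> /andP[_ ->]].
  by move=> /andP[tx xb]; rewrite tx xb (le_trans at_ tx).
rewrite -!integral_mkcond => /(congr1 fine) H.
have irp r (g : R -> R) : mu.-integrable `[a, b] (EFin \o g) ->
    mu.-integrable `[a, b] (EFin \o (fun x => r * g x)).
  by move=> ig; apply: eq_integrable (integrableZl _ r ig) => // x _ /=; rewrite EFinM.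
have {H} : \int[mu]_(t in `[a, b]) (p t * U t - U a * p t) =
  \int[mu]_(s in `[a, b]) (P b * v s - v s * P s) by exact: H.
have ip1 := irp (U a) p ip; have iv1 := irp (P b) v iv.
rewrite !RintegralB// !RintegralZl// -eP -eU; lra.
Qed.

Lemma primitive_on_mul p v P U a b :
  primitive_on `[a, b] P p -> primitive_on `[a, b] U v ->
  primitive_on `[a, b] (fun x => P x * U x) (fun x => p x * U x + v x * P x).
Proof.
move=> HP HU c d cab dab; rewrite le_eqVlt => /predU1P[->|cd].
  rewrite {2}set_itv1 Rintegral_set1 subrr; split=> //.
  have c1 (f : R -> R) : {within `[d, d], continuous f}.
    by rewrite set_itv1; exact: continuous_subspace1.
  have [ip _] := HP d d dab dab (lexx d); have [iv _] := HU d d dab dab (lexx d).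
  by apply: eq_integrable (integrableD _ (integrable_mul_within ip (c1 U))
    (integrable_mul_within iv (c1 P))).
have sub : `[c, d]%classic `<=` `[a, b]%classic.
  apply: subset_itv; rewrite bnd_simp.
    by move: cab; rewrite /= in_itv => /andP[].
  by move: dab; rewrite /= in_itv => /andP[].
by apply: (primitive_on_mul_ends cd); exact: primitive_onS sub _.
Qed.

End ByParts.

(** * Reflection at the origin and gluing at a point *)

Section Reflection.
Context {R : realType}.
Local Notation mu := (@lebesgue_measure R).
Implicit Types (f g : R -> R) (a b : R).

Lemma integral_oppr_setT g : mu.-integrable setT (EFin \o g) ->
  mu.-integrable setT (EFin \o (fun x => g (- x))) /\
  \int[mu]_x g (- x) = \int[mu]_x g x.
Proof.
move=> ig; have /measurable_EFinP mg := measurable_int _ ig.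
pose phi := (-%R : measurableTypeR R -> measurableTypeR R).
have mphi : measurable_fun setT phi by exact: oppr_measurable.
have mgN : measurable_fun setT (EFin \o (fun x : measurableTypeR R => g (- x))).
  by apply/measurable_EFinP; exact: (measurableT_comp mg mphi).
have igN : mu.-integrable setT (EFin \o (fun x => g (- x))).
  apply/integrableP; split=> //.
  have /integrableP[_] := ig; apply: le_lt_trans.
  rewrite -(@eq_measure_integral _ _ _ _ _ (pushforward mu phi)).
    rewrite ge0_integral_pushforward//.
      rewrite preimage_setT le_eqVlt; apply/orP; left; apply/eqP.
      by apply: eq_integral => x _ /=; rewrite /phi opprK.
    by apply: measurableT_comp => //.
  by move=> A mA _; exact: lebesgue_measureN.
split=> //; rewrite /Rintegral; congr fine.
rewrite -[RHS](@eq_measure_integral _ _ _ _ _ (pushforward mu phi)); last first.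
  by move=> A mA _; exact: lebesgue_measureN.
rewrite (integral_pushforward (phi := phi))//.
by apply/measurable_EFinP.
Qed.

Lemma integral_oppr (D : set (measurableTypeR R)) g : measurable D ->
  mu.-integrable D (EFin \o g) ->
  mu.-integrable (-%R @^-1` D) (EFin \o (fun x => g (- x))) /\
  \int[mu]_(x in -%R @^-1` D) g (- x) = \int[mu]_(x in D) g x.
Proof.
move=> mD ig; have mND : measurable (-%R @^-1` D : set (measurableTypeR R)).
  by rewrite -[X in measurable X]setTI; apply: (@oppr_measurable R setT).
have ig' : mu.-integrable setT (EFin \o (g \_ D)).
  by rewrite -restrict_EFin; apply/integrable_restrict => //=; rewrite setTI.
have [igN eN] := integral_oppr_setT ig'.
have E : (fun x => (g \_ D) (- x)) = (fun x => g (- x)) \_ (-%R @^-1` D).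
  apply/funext => x; rewrite !patchE.
  have -> : (x \in -%R @^-1` D) = (- x \in D) by apply/idP/idP => /set_mem/mem_set.
  by [].
split; last by rewrite Rintegral_mkcond -E eN -Rintegral_mkcond.
move: igN; rewrite E -restrict_EFin => /integrable_restrict.
by rewrite setTI; apply.
Qed.

Lemma primitive_on_oppr (I : set R) f g : primitive_on I f g ->
  primitive_on (-%R @^-1` I) (fun x => f (- x)) (fun x => - g (- x)).
Proof.
move=> H a b Ia Ib ab; have ba : - b <= - a by rewrite lerN2.
have [ig e] := H _ _ Ib Ia ba.
have [] := @integral_oppr `[- b, - a]%classic g (measurable_itv _) ig.
rewrite opp_preimage_itvbndbnd/= !opprK => igN eN; split.
  by apply: eq_integrable (integrableN igN) => // x _ /=.
have -> : \int[mu]_(x in `[a, b]) - g (- x) = - \int[mu]_(x in `[a, b]) g (- x).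
  by rewrite -mulN1r -RintegralZl//; apply: eq_Rintegral => x _; rewrite mulN1r.
by rewrite eN -e opprB.
Qed.

Lemma primitive_on_glue a f g :
  primitive_on `]-oo, a] f g -> primitive_on `[a, +oo[ f g -> primitive_on setT f g.
Proof.
move=> Hl Hr x y _ _ xy.
have Ila : `]-oo, a]%classic a by rewrite /= in_itv/=.
have Ira : `[a, +oo[%classic a by rewrite /= in_itv/= lexx.
have [ya|ay] := leP y a.
  by apply: Hl => //; rewrite /= in_itv/= // (le_trans xy).
have [ax|xa] := leP a x.
  by apply: Hr => //; rewrite /= in_itv/= andbT// ltW.
have [igl el] : mu.-integrable `[x, a] (EFin \o g) /\
    f a - f x = \int[mu]_(t in `[x, a]) g t.
  by apply: Hl => //; rewrite ?/= ?in_itv/= ltW.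
have [igr er] : mu.-integrable `[a, y] (EFin \o g) /\
    f y - f a = \int[mu]_(t in `[a, y]) g t.
  by apply: Hr => //; rewrite ?/= ?in_itv/= ?andbT ltW.
have ig : mu.-integrable `[x, y] (EFin \o g).
  have res (D : set (measurableTypeR R)) : measurable D -> mu.-integrable D (EFin \o g) ->
      mu.-integrable setT (EFin \o (g \_ D)).
    by move=> mD igD; rewrite -restrict_EFin; apply/integrable_restrict => //=; rewrite setTI.
  (* The point [a] is dropped from the right piece, so that the two restrictions add up to the
     restriction to [[x, y]]. *)
  have igr' : mu.-integrable `]a, y] (EFin \o g).
    by apply: integrableS igr => //; exact: subset_itv_oc_cc.
  have := integrableD measurableT (res `[x, a]%classic (measurable_itv _) igl)
    (res `]a, y]%classic (measurable_itv _) igr').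
  rewrite (_ : (_ \+ _)%E = (EFin \o g) \_ `[x, y]); last first.
    apply/funext => t; rewrite restrict_EFin /= -EFinD !patchE !mem_setE; congr EFin.
    rewrite !in_itv/=; have [ta|at_] := leP t a; rewrite ?andbT ?andbF ?addr0 ?add0r.
      by rewrite (le_trans ta (ltW ay)) andbT.
    by rewrite (le_trans (ltW xa) (ltW at_)).
  by move=> /integrable_restrict; rewrite setTI; apply.
by split=> //; rewrite (Rintegral_split (b := a)) ?ltW// -el -er; ring.
Qed.

End Reflection.

(** * The quasi-derivative system *)

Section Continuous.
Context {R : realType}.
Implicit Types (f g : R -> R).

Lemma contD f g : continuous f -> continuous g -> continuous (fun x => f x + g x).
Proof. by move=> cf cg x; apply: (@continuousD _ _ _ f g); [exact: cf|exact: cg]. Qed.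

Lemma contM f g : continuous f -> continuous g -> continuous (fun x => f x * g x).
Proof. by move=> cf cg x; apply: (@continuousM _ _ f g); [exact: cf|exact: cg]. Qed.

Lemma contN f : continuous f -> continuous (fun x => - f x).
Proof. by move=> cf x; apply: (@continuousN _ _ _ f); exact: cf. Qed.

Lemma contB f g : continuous f -> continuous g -> continuous (fun x => f x - g x).
Proof. by move=> cf cg; apply: contD => //; exact: contN. Qed.

Lemma cont_cst (k : R) : continuous (fun _ : R => k).
Proof. by move=> x; exact: cst_continuous. Qed.

Lemma cont_id : continuous (fun x : R => x).
Proof. by move=> x; exact: cvg_id. Qed.

Lemma contX f n : continuous f -> continuous (fun x => f x ^+ n).
Proof.
move=> cf; elim: n => [|n IH]; first exact: cont_cst.
rewrite (_ : (fun _ => _) = (fun x => f x * f x ^+ n)); first exact: contM.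
by apply/funext => x; rewrite exprS.
Qed.

End Continuous.

Section Volterra.
Context {R : realType}.
Local Notation mu := (@lebesgue_measure R).
Implicit Types (f g h u v w : R -> R) (a b c x : R).

(** For [x < 0] the interval is empty and the value is [0]. Solutions defined through [integral0]
    are therefore constant on the negative half-line and continuous everywhere; only [x >= 0]
    carries information. *)
Definition integral0 g x : R := \int[mu]_(t in `[0, x]) g t.

Lemma integral0_le0 g x : x <= 0 -> integral0 g x = 0.
Proof.
rewrite /integral0 le_eqVlt => /predU1P[->|x0]; first by rewrite set_itv1 Rintegral_set1.
by rewrite set_itv_ge ?Rintegral_set0// -leNgt bnd_simp.
Qed.

Lemma continuous_integrable_segment g : continuous g ->
  forall a b, mu.-integrable `[a, b] (EFin \o g).
Proof.
move=> cg a b; apply: continuous_compact_integrable; first exact: segment_compact.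
exact: continuous_subspaceT.
Qed.

Lemma integral0_continuous g : (forall a b, mu.-integrable `[a, b] (EFin \o g)) -> continuous (integral0 g).
Proof. by move=> ig; exact: continuous_Rintegral. Qed.

Lemma integral0_is_derive g x : (forall a b, mu.-integrable `[a, b] (EFin \o g)) ->
  {for x, continuous g} -> 0 < x -> is_derive x 1 (integral0 g) (g x).
Proof.
move=> ig cg x0; have x1 : x < x + 1 by lra.
have [d1 d2] := continuous_FTC1_closed x1 (ig 0 (x + 1)) x0 cg.
by apply: DeriveDef => //; rewrite -derive1E.
Qed.

Lemma Rintegral_monomial k n x : 0 <= x ->
  \int[mu]_(t in `[0, x]) (k * t ^+ n) = k * x ^+ n.+1 / n.+1%:R.
Proof.
rewrite le_eqVlt => /predU1P[<-|x0].
  by rewrite set_itv1 Rintegral_set1 expr0n/= mulr0 mul0r.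
have cf : continuous (fun t : R => k * t ^+ n).
  by apply: contM; [exact: cont_cst|apply: contX; exact: cont_id].
pose F (t : R) := k * t ^+ n.+1 / n.+1%:R.
have dF (t : R) : is_derive t 1 F (k * t ^+ n).
  have -> : F = (k / n.+1%:R) \*: (id ^+ n.+1).
    by apply/funext => s; rewrite /F !fctE /= /GRing.scale /= mulrAC.
  apply: is_derive_eq; rewrite /GRing.scale/= /GRing.scale/= mulr1.
  by rewrite mulrA divfK// pnatr_eq0.
have cF : continuous F.
  by move=> t; apply: differentiable_continuous; apply/derivable1_diffP; exact: ex_derive.
rewrite /Rintegral (continuous_FTC2 (F := F) x0) /=.
- by rewrite /F expr0n/= mulr0 mul0r subr0.
- exact: continuous_subspaceT.
- split=> [t _||]; first exact: ex_derive.
    by apply: cvg_at_right_filter; exact: cF.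
  by apply: cvg_at_left_filter; exact: cF.
- by move=> t _; rewrite derive1E; exact: derive_val.
Qed.

(** One step of the factorial estimates below. The two components are bounded together because the
    system mixes them. *)
Lemma integral0_le2 g h k n x : 0 <= x ->
  mu.-integrable `[0, x] (EFin \o g) -> mu.-integrable `[0, x] (EFin \o h) ->
  (forall t, 0 <= t <= x -> `|g t| + `|h t| <= k * t ^+ n) ->
  `|integral0 g x| + `|integral0 h x| <= k * x ^+ n.+1 / n.+1%:R.
Proof.
move=> x0 ig ih gh.
apply: (@le_trans _ _ (\int[mu]_(t in `[0, x]) (`|g t| + `|h t|))).
  have ign : mu.-integrable `[0, x] (EFin \o (fun t => `|g t|)) by exact: integrable_norm.
  have ihn : mu.-integrable `[0, x] (EFin \o (fun t => `|h t|)) by exact: integrable_norm.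
  by rewrite RintegralD// lerD// le_normr_Rintegral.
rewrite -Rintegral_monomial//; apply: le_Rintegral => //.
- by apply: eq_integrable (integrableD _ (integrable_norm ig) (integrable_norm ih)).
- apply: continuous_integrable_segment.
  by apply: contM; [exact: cont_cst|apply: contX; exact: cont_id].
Qed.

Lemma integral0D g h r s x : mu.-integrable `[0, x] (EFin \o g) ->
  mu.-integrable `[0, x] (EFin \o h) ->
  integral0 (fun t => r * g t + s * h t) x = r * integral0 g x + s * integral0 h x.
Proof.
move=> ig ih; rewrite /integral0 RintegralD// ?RintegralZl//.
  by apply: eq_integrable (integrableZl _ r ig) => // t _ /=; rewrite EFinM.
by apply: eq_integrable (integrableZl _ s ih) => // t _ /=; rewrite EFinM.
Qed.

Lemma integral0_primitive g : (forall a b, mu.-integrable `[a, b] (EFin \o g)) ->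
  primitive_on `[0, +oo[ (integral0 g) g.
Proof.
move=> ig a b; rewrite /= !in_itv/= !andbT => a0 b0 ab; split; first exact: ig.
by rewrite /integral0 (Rintegral_split (b := a))//; ring.
Qed.

End Volterra.

(** * Existence by Picard iteration *)

Section Existence.
Context {R : realType}.
Local Notation mu := (@lebesgue_measure R).
Variables (Q : R -> R) (B : R).
Hypotheses (cQ : continuous Q) (bQ : forall x, `|Q x| <= B).
Variables (l u0 w0 : R).

(* [w] stands for the quasi-derivative [u' - Q u]; when [Q' = q], the system below is
   [- u'' + q u = l u]. *)
Definition vel (u w : R -> R) (x : R) := Q x * u x + w x.
Definition acc (u w : R -> R) (x : R) := - (l + Q x ^+ 2) * u x - Q x * w x.

Record solution (u w : R -> R) : Prop := Solution {
  sol_contu : continuous u;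
  sol_contw : continuous w;
  sol_u : forall x, u x = u 0 + integral0 (vel u w) x;
  sol_w : forall x, w x = w 0 + integral0 (acc u w) x }.

(** The system is linear, so the [n]-th term is taken to be the [n]-th correction; the partial sums
    are the usual Picard iterates, as [picard_sumS] records. *)
Fixpoint picard (n : nat) : (R -> R) * (R -> R) :=
  if n is m.+1 then
    (integral0 (vel (picard m).1 (picard m).2), integral0 (acc (picard m).1 (picard m).2))
  else (cst u0, cst w0).

Let up n := (picard n).1.
Let wp n := (picard n).2.

(** [C] dominates the two column sums [B + |l| + B^2] and [1 + B] of the coefficient matrix. *)
Let C : R := 1 + B + `|l| + B ^+ 2.
Let M : R := `|u0| + `|w0|.

Lemma bound_ge0 : 0 <= B. Proof. exact: le_trans (normr_ge0 (Q 0)) (bQ 0). Qed.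

Lemma vel_acc_le (u w : R -> R) x : `|vel u w x| + `|acc u w x| <= C * (`|u x| + `|w x|).
Proof.
have B0 := bound_ge0; rewrite /vel /acc.
have Qx := bQ x; have Q0 := normr_ge0 (Q x).
have Q2 : `|Q x ^+ 2| <= B ^+ 2 by rewrite normrX lerXn2r ?nnegrE.
apply: (@le_trans _ _ ((`|Q x| * `|u x| + `|w x|) + ((`|l| + `|Q x ^+ 2|) * `|u x| + `|Q x| * `|w x|))).
  apply: lerD; first by apply: (le_trans (ler_normD _ _)); rewrite normrM.
  apply: (le_trans (ler_normB _ _)); rewrite normrM [`|Q x * w x|]normrM normrN lerD2r ler_wpM2r//.
  by rewrite ler_normD.
have u_0 := normr_ge0 (u x); have w_0 := normr_ge0 (w x); have l0 := normr_ge0 l.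
have B2 := sqr_ge0 B.
rewrite /C; nra.
Qed.

Lemma vel_cont u w : continuous u -> continuous w -> continuous (vel u w).
Proof. by move=> cu cw; apply: contD => //; exact: contM. Qed.

Lemma acc_cont u w : continuous u -> continuous w -> continuous (acc u w).
Proof.
move=> cu cw; apply: contB; last exact: contM.
by apply: contM => //; apply: contN; apply: contD; [exact: cont_cst|exact: contX].
Qed.

Lemma picard_cont n : continuous (up n) /\ continuous (wp n).
Proof.
elim: n => [|n [cu cw]]; first by split; exact: cont_cst.
split; apply: integral0_continuous; apply: continuous_integrable_segment.
  exact: vel_cont.
exact: acc_cont.
Qed.

(** Each integration contributes a factor [C x / n.+1], so that the exponential series is a
    majorant. For [x <= 0] all terms after the first vanish. *)
Lemma picard_le n x : `|up n x| + `|wp n x| <= M * exp_coeff (C * `|x|) n.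
Proof.
have C0 : 0 <= C by rewrite /C; have := bound_ge0; have := normr_ge0 l; have := sqr_ge0 B; lra.
have M0 : 0 <= M by rewrite addr_ge0.
elim: n x => [|n IH] x; first by rewrite /exp_coeff/= expr0 fact0 divr1 mulr1.
have [x0|x0] := leP x 0.
  rewrite /up /wp /= !integral0_le0// normr0 addr0 mulr_ge0// exp_coeff_ge0// mulr_ge0//.
have [cu cw] := picard_cont n.
pose k := M * C ^+ n.+1 / n`!%:R.
have xx := ltW x0.
apply: (le_trans (integral0_le2 (k := k) (n := n) xx _ _ _)).
- exact: continuous_integrable_segment (vel_cont cu cw) _ _.
- exact: continuous_integrable_segment (acc_cont cu cw) _ _.
- move=> t /andP[t0 tx]; apply: (le_trans (vel_acc_le _ _ _)).
  apply: (le_trans (ler_wpM2l C0 (IH t))).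
  rewrite /exp_coeff /= ger0_norm// /k exprMn exprS.
  by rewrite le_eqVlt; apply/orP; left; apply/eqP; ring.
- rewrite /exp_coeff /= ger0_norm// /k factS natrM exprMn invfM.
  by rewrite le_eqVlt; apply/orP; left; apply/eqP; ring.
Qed.

Let Su (x : R) n := series (fun k => up k x) n.
Let Sw (x : R) n := series (fun k => wp k x) n.
Let u (x : R) : R := limn (Su x).
Let w (x : R) : R := limn (Sw x).

Lemma growth_ge0 : 0 <= C.
Proof. by rewrite /C; have := bound_ge0; have := normr_ge0 l; have := sqr_ge0 B; lra. Qed.

Let majorant_cvg (x : R) : cvgn (series (M *: exp_coeff (C * `|x|))).
Proof. by apply: is_cvg_seriesZ; exact: is_cvg_series_exp_coeff. Qed.

Lemma picard_cvg x : cvgn (Su x) /\ cvgn (Sw x).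
Proof.
have maj0 n : 0 <= (M *: exp_coeff (C * `|x|)) n.
  by rewrite mulr_ge0 ?addr_ge0// exp_coeff_ge0// mulr_ge0// growth_ge0.
split; apply: normed_cvg.
  apply: (series_le_cvg (u_ := fun n => `|up n x|) _ maj0 _ (@majorant_cvg x)) => // n.
  by apply: le_trans (picard_le n x); rewrite lerDl.
apply: (series_le_cvg (u_ := fun n => `|wp n x|) _ maj0 _ (@majorant_cvg x)) => // n.
by apply: le_trans (picard_le n x); rewrite lerDr.
Qed.

Lemma picard_sum_le x n : `|Su x n| + `|Sw x n| <= M * expR (C * `|x|).
Proof.
have M0 : 0 <= M by rewrite addr_ge0.
have Cx : 0 <= C * `|x| by rewrite mulr_ge0// growth_ge0.
apply: (@le_trans _ _ (M * series (exp_coeff (C * `|x|)) n)).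
  elim: n => [|n IH]; first by rewrite /Su /Sw /series/= !big_geq// normr0 mulr0 addr0.
  rewrite /Su /Sw !seriesSr mulrDr.
  have := picard_le n x; have := ler_normD (Su x n) (up n x).
  have := ler_normD (Sw x n) (wp n x); move: IH; rewrite /Su /Sw; lra.
rewrite ler_wpM2l//; apply: nondecreasing_cvgn_le; last exact: is_cvg_series_exp_coeff.
by apply: nondecreasing_series => k _ _; exact: exp_coeff_ge0.
Qed.

(** Dominated convergence with a constant majorant. The limit is not yet known to be continuous; it
    is measurable as a pointwise limit. *)
Let bound (f : R -> R^nat) (g : R -> R) a b K : (forall n, continuous (fun x => f x n)) ->
  (forall x, f x n @[n --> \oo] --> g x) -> (forall x n, a <= x <= b -> `|f x n| <= K) ->
  mu.-integrable `[a, b] (EFin \o g) /\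
  \int[mu]_(x in `[a, b]) f x n @[n --> \oo] --> \int[mu]_(x in `[a, b]) g x.
Proof.
move=> cf fg fK.
have mf n : measurable_fun `[a, b] (EFin \o (fun x => f x n)).
  exact: measurable_int (continuous_integrable_segment (cf n) a b).
have fg' x : `[a, b]%classic x -> (f x n)%:E @[n --> \oo] --> (g x)%:E.
  by move=> _; apply: cvg_EFin; [exact: nearW|exact: fg].
have iK : mu.-integrable `[a, b] (EFin \o cst K).
  exact: continuous_integrable_segment (@cont_cst _ K) a b.
have mg : measurable_fun `[a, b] (EFin \o g) by exact: emeasurable_fun_cvg mf fg'.
have [||ig _] := @dominated_convergence _ _ _ mu `[a, b]%classic (measurable_itv _)
    (fun n => EFin \o (fun x => f x n)) (EFin \o g) (EFin \o cst K) mf mg _ iK.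
- by apply: aeW => x; exact: fg'.
- by apply: aeW => x n xab; rewrite /= lee_fin fK.
rewrite EFin_Rintegral// => cv; split=> //.
by move: cv => /fine_cvg; apply: cvg_trans; apply: near_eq_cvg; exact: nearW.
Qed.

Lemma picard_sum_cont n : continuous (fun x => Su x n) /\ continuous (fun x => Sw x n).
Proof.
elim: n => [|n [cu cw]].
  have -> : (fun x => Su x 0) = cst 0 by apply/funext => x; rewrite /Su /series/= big_geq.
  have -> : (fun x => Sw x 0) = cst 0 by apply/funext => x; rewrite /Sw /series/= big_geq.
  by split; exact: cont_cst.
have [cu' cw'] := picard_cont n.
have -> : (fun x => Su x n.+1) = (fun x => Su x n + up n x).
  by apply/funext => x; rewrite /Su seriesSr.
have -> : (fun x => Sw x n.+1) = (fun x => Sw x n + wp n x).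
  by apply/funext => x; rewrite /Sw seriesSr.
by split; exact: contD.
Qed.

Let vel_acc_int a b :
  [/\ mu.-integrable `[a, b] (EFin \o vel u w), mu.-integrable `[a, b] (EFin \o acc u w),
    \int[mu]_(x in `[a, b]) vel (Su^~ n) (Sw^~ n) x @[n --> \oo] --> \int[mu]_(x in `[a, b]) vel u w x &
    \int[mu]_(x in `[a, b]) acc (Su^~ n) (Sw^~ n) x @[n --> \oo] --> \int[mu]_(x in `[a, b]) acc u w x].
Proof.
pose K := C * (M * expR (C * (`|a| + `|b|))).
have C0 := growth_ge0; have M0 : 0 <= M by rewrite addr_ge0.
have K1 n x : a <= x <= b -> `|vel (Su^~ n) (Sw^~ n) x| + `|acc (Su^~ n) (Sw^~ n) x| <= K.
  move=> /andP[ax xb]; apply: (le_trans (vel_acc_le _ _ _)); rewrite /K ler_wpM2l//.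
  apply: (le_trans (picard_sum_le _ _)); rewrite ler_wpM2l// ler_expR ler_wpM2l//.
  rewrite ler_norml; have := ler_norm b; have := ler_norm (- a); rewrite normrN.
  have := normr_ge0 a; have := normr_ge0 b; move=> *; apply/andP; split; lra.
have [] := @bound (fun x n => vel (Su^~ n) (Sw^~ n) x) (vel u w) a b K.
- by move=> n; have [cu cw] := picard_sum_cont n; exact: vel_cont.
- move=> x; have [cu cw] := picard_cvg x.
  by apply: cvgD => //; apply: cvgM => //; exact: cvg_cst.
- by move=> x n /(K1 n); apply: le_trans; rewrite lerDl.
move=> iv cv; have [] := @bound (fun x n => acc (Su^~ n) (Sw^~ n) x) (acc u w) a b K.
- by move=> n; have [cu cw] := picard_sum_cont n; exact: acc_cont.
- move=> x; have [cu cw] := picard_cvg x.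
  by apply: cvgB; apply: cvgM => //; exact: cvg_cst.
- by move=> x n /(K1 n); apply: le_trans; rewrite lerDr.
by [].
Qed.

Let picard_sumS x n : Su x n.+1 = u0 + integral0 (vel (Su^~ n) (Sw^~ n)) x /\
  Sw x n.+1 = w0 + integral0 (acc (Su^~ n) (Sw^~ n)) x.
Proof.
elim: n => [|n [IHu IHw]].
  have S0 y : Su y 0%N = 0 by rewrite /Su /series/= big_geq.
  have S0' y : Sw y 0%N = 0 by rewrite /Sw /series/= big_geq.
  have -> : vel (Su^~ 0%N) (Sw^~ 0%N) = cst 0.
    by apply/funext => y; rewrite /vel S0 S0' mulr0 addr0.
  have -> : acc (Su^~ 0%N) (Sw^~ 0%N) = cst 0.
    by apply/funext => y; rewrite /acc S0 S0' !mulr0 subrr.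
  have -> : integral0 (cst 0 : R -> R) x = 0 by rewrite /integral0 Rintegral_cst// mul0r.
  by rewrite {1}/Su {1}/Sw !seriesSr -/(Su x 0%N) -/(Sw x 0%N) S0 S0' !add0r !addr0.
have [cu cw] := picard_sum_cont n; have [cu' cw'] := picard_cont n.
have jv := @integral0D R (vel (Su^~ n) (Sw^~ n)) (vel (up n) (wp n)) 1 1 x
  (continuous_integrable_segment (vel_cont cu cw) _ _)
  (continuous_integrable_segment (vel_cont cu' cw') _ _).
have ja := @integral0D R (acc (Su^~ n) (Sw^~ n)) (acc (up n) (wp n)) 1 1 x
  (continuous_integrable_segment (acc_cont cu cw) _ _)
  (continuous_integrable_segment (acc_cont cu' cw') _ _).
rewrite {1}/Su {2}/Sw !(seriesSr _ n.+1) -/(Su x n.+1) -/(Sw x n.+1) IHu IHw.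
split.
- rewrite -addrA -[integral0 _ _]mul1r -[up _ _]mul1r /up /= -/(up n) -/(wp n) -jv; congr (_ + integral0 _ _).
  by apply/funext => t; rewrite /vel /Su /Sw !seriesSr; ring.
- rewrite -addrA -[integral0 _ _]mul1r -[wp _ _]mul1r /wp /= -/(up n) -/(wp n) -ja; congr (_ + integral0 _ _).
  by apply/funext => t; rewrite /acc /Su /Sw !seriesSr; ring.
Qed.

(** The integral equations come from passing to the limit in the Picard recursion; continuity of the
    limits is then read off from these equations. *)
Lemma solution_exists : exists u w, [/\ solution u w, u 0 = u0 & w 0 = w0].
Proof.
have eu x : u x = u0 + integral0 (vel u w) x.
  have [cu _] := picard_cvg x; apply: (cvg_unique (@Rhausdorff R) cu).
  rewrite /= -cvg_shiftS; have [_ _ cv _] := vel_acc_int 0 x.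
  under eq_fun do rewrite (picard_sumS x _).1.
  by apply: cvgD => //; exact: cvg_cst.
have ew x : w x = w0 + integral0 (acc u w) x.
  have [_ cw] := picard_cvg x; apply: (cvg_unique (@Rhausdorff R) cw).
  rewrite /= -cvg_shiftS; have [_ _ _ ca] := vel_acc_int 0 x.
  under eq_fun do rewrite (picard_sumS x _).2.
  by apply: cvgD => //; exact: cvg_cst.
have u00 : u 0 = u0 by rewrite eu integral0_le0// addr0.
have w00 : w 0 = w0 by rewrite ew integral0_le0// addr0.
exists u, w; split=> //; split.
- rewrite (_ : u = (fun x => u0 + integral0 (vel u w) x)); last exact/funext.
  by apply: contD; [exact: cont_cst|apply: integral0_continuous => a b; have [] := vel_acc_int a b].
- rewrite (_ : w = (fun x => w0 + integral0 (acc u w) x)); last exact/funext.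
  by apply: contD; [exact: cont_cst|apply: integral0_continuous => a b; have [] := vel_acc_int a b].
- by move=> x; rewrite u00.
- by move=> x; rewrite w00.
Qed.

End Existence.

(** * Uniqueness, and the passage between the system and the differential equation *)

Section Uniqueness.
Context {R : realType}.
Local Notation mu := (@lebesgue_measure R).
Variables (Q : R -> R) (B : R).
Hypotheses (cQ : continuous Q) (bQ : forall x, `|Q x| <= B).
Variable l : R.

Lemma integrable_segment_within (g : R -> R) a b : {within `[a, b], continuous g} ->
  mu.-integrable `[a, b] (EFin \o g).
Proof. by move=> cg; apply: continuous_compact_integrable => //; exact: segment_compact. Qed.

Lemma within_continuousM_segment (g h : R -> R) (a b : R) :
  {within `[a, b], continuous g} -> {within `[a, b], continuous h} ->
  {within `[a, b], continuous (fun x => g x * h x)}.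
Proof. by move=> cg ch x; apply: (@continuousM _ _ (g : subspace _ -> R) h x); [exact: cg|exact: ch]. Qed.

Lemma vel_acc_within c (u w : R -> R) :
  {within `[0, c], continuous u} -> {within `[0, c], continuous w} ->
  {within `[0, c], continuous (vel Q u w)} /\ {within `[0, c], continuous (acc Q l u w)}.
Proof.
move=> cu cw; have cQ' : {within `[0, c], continuous Q} by exact: continuous_subspaceT.
split.
  apply: (@within_continuousD _ _ _ _ (fun x => Q x * u x) w) => //.
  exact: within_continuousM_segment.
apply: (@within_continuousB _ _ _ _ (fun x => - (l + Q x ^+ 2) * u x) (fun x => Q x * w x)).
  apply: within_continuousM_segment => //; apply: continuous_subspaceT.
  by apply: contN; apply: contD; [exact: cont_cst|exact: contX].
exact: within_continuousM_segment.
Qed.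

(** Starting from any bound [M], feeding the estimate back into the equations [n] times gives
    [M (C x)^n / n!], which tends to [0]. Continuity is asked on [[0, c]] only, since the lemma is
    applied to functions known only there. *)
Lemma volterra_eq0 c (u w : R -> R) : 0 < c ->
  {within `[0, c], continuous u} -> {within `[0, c], continuous w} ->
  (forall x, 0 <= x <= c -> u x = integral0 (vel Q u w) x) ->
  (forall x, 0 <= x <= c -> w x = integral0 (acc Q l u w) x) ->
  forall x, 0 <= x <= c -> u x = 0 /\ w x = 0.
Proof.
move=> c0 cu cw eu ew.
have [cv ca] := vel_acc_within cu cw.
pose C : R := 1 + B + `|l| + B ^+ 2.
have C0 : 0 <= C by exact: growth_ge0.
have [M hM] : exists M : R, forall x, 0 <= x <= c -> `|u x| + `|w x| <= M.
  have bnd (g : R -> R) : {within `[0, c], continuous g} -> exists M : R, forall x, 0 <= x <= c -> `|g x| <= M.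
    move=> cg; have cgn : {within `[0, c], continuous (fun x => `|g x|)}.
      by move=> x; apply: (@continuous_comp (subspace `[0, c]) _ _ g Num.norm); [exact: cg|exact: norm_continuous].
    have [K _ HK] := EVT_max (ltW c0) cgn.
    exists `|g K| => x x0c; apply: HK; by rewrite in_itv.
  have [M1 h1] := bnd _ cu; have [M2 h2] := bnd _ cw.
  by exists (M1 + M2) => x x0c; rewrite lerD ?h1 ?h2.
have le n x : 0 <= x <= c -> `|u x| + `|w x| <= M * exp_coeff (C * x) n.
  elim: n x => [|n IH] x x0c.
    by rewrite /exp_coeff/= expr0 fact0 divr1 mulr1; exact: hM.
  have /andP[x0 xc] := x0c.
  pose k := M * C ^+ n.+1 / n`!%:R.
  rewrite eu// ew//; apply: (le_trans (integral0_le2 (k := k) (n := n) x0 _ _ _)).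
  - by apply: integrable_subitv (integrable_segment_within cv).
  - by apply: integrable_subitv (integrable_segment_within ca).
  - move=> t /andP[t0 tx]; apply: (le_trans (vel_acc_le bQ _ _ _ _)).
    have t0c : 0 <= t <= c by rewrite t0 (le_trans tx).
    apply: (le_trans (ler_wpM2l C0 (IH t t0c))).
    rewrite /exp_coeff /= /k exprMn exprS.
    by rewrite le_eqVlt; apply/orP; left; apply/eqP; ring.
  - rewrite /exp_coeff /= /k factS natrM exprMn invfM.
    by rewrite le_eqVlt; apply/orP; left; apply/eqP; ring.
move=> x x0c; have : `|u x| + `|w x| <= 0.
  have cv0 : M * exp_coeff (C * x) n @[n --> \oo] --> M * 0.
    by apply: cvgM; [exact: cvg_cst|exact: cvg_exp_coeff].
  rewrite mulr0 in cv0; apply: (cvgr_to_ge cv0).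
  by apply: nearW => n; exact: le.
have := normr_ge0 (u x); have := normr_ge0 (w x) => w0' u0' H.
by split; apply/eqP; rewrite -normr_le0; lra.
Qed.

End Uniqueness.

Section Bridge.
Context {R : realType}.
Local Notation mu := (@lebesgue_measure R).
Variables (p Q : R -> R) (B : R).
Hypotheses (cQ : continuous Q) (bQ : forall x, `|Q x| <= B) (Q0 : Q 0 = 0).
Hypothesis pQ : primitive_on setT Q p.
Implicit Types (f u w : R -> R) (l c : R).

Definition ae_on (I : set R) (f g : R -> R) := {ae mu, forall x, I x -> f x = g x}.

(** By the product rule [Q u + w] has derivative [p u + Q u' + w'], and the definition of [acc]
    makes the last two terms add up to [- l u]. *)
Lemma solution_ode l u w : solution Q l u w ->
  primitive_on `[0, +oo[ u (vel Q u w) /\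
  primitive_on `[0, +oo[ (vel Q u w) (fun x => (p x - l) * u x).
Proof.
move=> s; have cv := vel_cont cQ (sol_contu s) (sol_contw s).
have ca := acc_cont cQ (l := l) (sol_contu s) (sol_contw s).
have shift f g k : (forall x, f x = k + integral0 g x) -> continuous g -> primitive_on `[0, +oo[ f g.
  move=> fE cg a b a0 b0 ab; rewrite !fE opprD addrACA subrr add0r.
  exact: integral0_primitive (continuous_integrable_segment cg) a b a0 b0 ab.
have hu := shift _ _ _ (sol_u s) cv; have hw := shift _ _ _ (sol_w s) ca.
split=> // a b a0 b0 ab.
have sub : `[a, b]%classic `<=` `[0, +oo[%classic.
  by apply: subset_itv; rewrite bnd_simp//; move: a0; rewrite /= in_itv/= andbT.
have HQu := primitive_on_mul (primitive_onS (fun x _ => I) pQ) (primitive_onS sub hu).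
have := primitive_on_lin 1 1 HQu (primitive_onS sub hw).
move=> /(_ a b); rewrite /= !in_itv/= !lexx ab => /(_ isT isT isT)[ig e].
have E x : 1 * (p x * u x + vel Q u w x * Q x) + 1 * acc Q l u w x = (p x - l) * u x.
  by rewrite /vel /acc; ring.
split; first by apply: eq_integrable ig => // x _ /=; rewrite E.
under eq_Rintegral do rewrite -E.
by rewrite -e /vel; ring.
Qed.

(** With [w' = f1 - Q f] the potential cancels, and [(f, w')] satisfies the same integral equations
    as [(u, w)]. The initial values agree because [Q 0 = 0], so uniqueness applies. The equation for
    [f2] is used only under the integral sign, where almost everywhere is enough. *)
Lemma ode_solution l c f (f1 f2 : R -> R) u w : 0 < c -> solution Q l u w ->
  u 0 = f 0 -> w 0 = f1 0 ->
  primitive_on `[0, c] f f1 -> primitive_on `[0, c] f1 f2 ->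
  ae_on `[0, c] f2 (fun x => (p x - l) * f x) ->
  forall x, 0 <= x <= c -> f x = u x /\ f1 x = vel Q u w x.
Proof.
move=> c0 s u0 w0 hf hf1 ae.
have cf := primitive_on_within c0 hf; have cf1 := primitive_on_within c0 hf1.
have cQ' : {within `[0, c], continuous Q} by exact: continuous_subspaceT.
have hQf := primitive_on_mul (primitive_onS (fun x _ => I) pQ) hf.
pose w' x := f1 x - Q x * f x.
have cw' : {within `[0, c], continuous w'}.
  apply: (@within_continuousB _ _ _ _ f1 (fun x => Q x * f x)) => //.
  exact: within_continuousM_segment.
have iv g h : {within `[0, c], continuous g} -> {within `[0, c], continuous h} ->
    forall x, 0 <= x <= c -> mu.-integrable `[0, x] (EFin \o vel Q g h) /\
      mu.-integrable `[0, x] (EFin \o acc Q l g h).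
  move=> cg ch x /andP[x0 xc].
  have [cv ca] := vel_acc_within cQ l cg ch.
  by split; apply: (integrable_subitv (lexx 0) xc); exact: integrable_segment_within.
have hw' : forall x, 0 <= x <= c -> w' x = w' 0 + integral0 (acc Q l f w') x.
  move=> x x0c; have /andP[x0 xc] := x0c.
  have := primitive_on_lin 1 (-1) hf1 hQf.
  move=> /(_ 0 x); rewrite /= !in_itv/= !lexx x0 xc (le_trans x0 xc) => /(_ isT isT isT)[ig e].
  rewrite /w' -[LHS](subrKC (f1 0 - Q 0 * f 0)); congr (_ + _).
  transitivity (1 * f1 x + -1 * (Q x * f x) - (1 * f1 0 + -1 * (Q 0 * f 0))); first by ring.
  rewrite e /integral0; congr fine; apply: ae_eq_integral => //.
  - exact: measurable_int ig.
  - by have [_ /measurable_int] := iv _ _ cf cw' x x0c.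
  - move: ae; apply: filterS; first exact: (ae_filter_ringOfSetsType mu).
    move=> t + /= tx; rewrite in_itv/= in tx => /= ->.
      by congr EFin; rewrite /acc /w'; ring.
    by rewrite in_itv/=; have /andP[-> /le_trans->] := tx.
have hf' : forall x, 0 <= x <= c -> f x = f 0 + integral0 (vel Q f w') x.
  move=> x /andP[x0 xc]; have := hf 0 x.
  rewrite /= !in_itv/= !lexx x0 xc (le_trans x0 xc) => /(_ isT isT isT)[ig e].
  rewrite -[LHS](subrKC (f 0)) e /integral0; congr (_ + _).
  by apply: eq_Rintegral => t _; rewrite /vel /w'; ring.
have cu : {within `[0, c], continuous u} by apply: continuous_subspaceT; exact: sol_contu s.
have cw : {within `[0, c], continuous w} by apply: continuous_subspaceT; exact: sol_contw s.
have Z : forall x, 0 <= x <= c -> f x - u x = 0 /\ w' x - w x = 0.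
  apply: (volterra_eq0 cQ bQ (l := l) c0).
  - exact: (@within_continuousB _ _ _ _ f u).
  - exact: (@within_continuousB _ _ _ _ w' w).
  - move=> x x0c; rewrite hf'// (sol_u s) u0.
    have [iv1 ia1] := iv _ _ cf cw' x x0c; have [iv2 ia2] := iv _ _ cu cw x x0c.
    rewrite opprD addrACA subrr add0r -[integral0 (vel Q f w') x]mul1r -[- integral0 _ _]mulN1r -integral0D//.
    by congr integral0; apply/funext => t; rewrite /vel; ring.
  - move=> x x0c; rewrite hw'// (sol_w s) w0 {1}/w' Q0 mul0r subr0.
    have [iv1 ia1] := iv _ _ cf cw' x x0c; have [iv2 ia2] := iv _ _ cu cw x x0c.
    rewrite opprD addrACA subrr add0r -[integral0 (acc Q l f w') x]mul1r -[- integral0 _ _]mulN1r -integral0D//.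
    by congr integral0; apply/funext => t; rewrite /acc; ring.
move=> x /Z[/subr0_eq fu /subr0_eq ww]; split=> //.
by rewrite /vel -ww -fu /w' addrC subrK.
Qed.

Lemma solution_is_derive l u w (x : R) : solution Q l u w -> 0 < x ->
  is_derive x 1 u (vel Q u w x) /\ is_derive x 1 w (acc Q l u w x).
Proof.
move=> s x0; have cv := vel_cont cQ (sol_contu s) (sol_contw s).
have ca := acc_cont cQ (l := l) (sol_contu s) (sol_contw s).
have dJ g k : continuous g -> is_derive x 1 (fun t => k + integral0 g t) (g x).
  move=> cg; have H := integral0_is_derive (continuous_integrable_segment cg) (cg x) x0.
  rewrite -[g x]add0r; exact: is_deriveD.
split.
- have E : (fun t => u 0 + integral0 (vel Q u w) t) = u by apply/funext => t; rewrite -(sol_u s).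
  by have := dJ _ (u 0) cv; rewrite E.
- have E : (fun t => w 0 + integral0 (acc Q l u w) t) = w by apply/funext => t; rewrite -(sol_w s).
  by have := dJ _ (w 0) ca; rewrite E.
Qed.

End Bridge.

(** * Alternation of eigenvalues *)

Section SpectralCurve.
Context {R : realType}.
Implicit Types (f g U V : R -> R) (z l c s : R).

Lemma crossing_mul s f g z c : continuous g -> 0 < c * g z ->
  crossing s (fun l => f l * c) z -> crossing s (fun l => f l * g l) z.
Proof.
move=> cg cgz [e e0 he].
have [e' e'0 he'] := continuous_pos_near (contM (@cont_cst _ c) cg) cgz.
exists (Num.min e e'); first by rewrite lt_min e0.
move=> l /andP[l0]; rewrite lt_min => /andP[le le'].
have h1 : 0 < s * (l - z) * (f l * c) by apply: he; rewrite l0.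
have h2 := he' _ le'.
have c2 : 0 < c ^+ 2.
  by rewrite exprn_even_gt0//=; apply/eqP => c0; move: h2; rewrite c0 mul0r ltxx.
rewrite -(pmulr_lgt0 _ c2); have := mulr_gt0 h1 h2.
by congr (0 < _); ring.
Qed.

Lemma crossingN s f z : crossing s (fun l => - f l) z -> crossing (- s) f z.
Proof. by case=> e e0 he; exists e => // x /he; rewrite mulrN mulNr mulNr. Qed.

(* [Num.sqrt] is [0] on negative numbers, so that [kappa] is continuous on the whole line. *)
Definition kappa (l : R) : R := Num.sqrt (- l).
Definition Robin (U V : R -> R) (l : R) : R := V l + kappa l * U l.

Lemma kappa_cont : continuous kappa.
Proof.
move=> l; apply: (@continuous_comp _ _ _ (fun x => - x) (@Num.sqrt R)).
  exact: contN (@cont_id R) l.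
exact: sqrt_continuous.
Qed.

Lemma kappa_gt0 l : l < 0 -> 0 < kappa l.
Proof. by move=> l0; rewrite sqrtr_gt0 oppr_gt0. Qed.

Lemma kappa_decr l z : z < 0 -> l != z -> (l - z) * (kappa l - kappa z) < 0.
Proof.
move=> z0 lz; rewrite /kappa; have [lt|lt|E] := ltgtP l z; last by rewrite E eqxx in lz.
  rewrite nmulr_rlt0 ?subr_lt0// subr_gt0 ltr_sqrt; lra.
by rewrite pmulr_rlt0 ?subr_gt0// subr_lt0 ltr_sqrt; lra.
Qed.

(** The plane vector [(U l, V l)] lies in the open first quadrant for very negative [l] and turns
    clockwise as [l] grows; [curve_turn] expresses the rotation by the sign of a determinant instead
    of the derivative of an angle. *)
Record curve U V : Prop := Curve {
  curve_contU : continuous U;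
  curve_contV : continuous V;
  curve_turn : forall z, exists2 e, 0 < e & forall l, 0 < `|l - z| < e ->
    0 < (l - z) * (U l * V z - V l * U z);
  curve_pos : exists l0, forall l, l <= l0 -> 0 < U l /\ 0 < V l }.

Lemma Robin_cont U V : curve U V -> continuous (Robin U V).
Proof.
by move=> h; apply: contD; [exact: curve_contV h|apply: contM; [exact: kappa_cont|exact: curve_contU h]].
Qed.

Definition negative_zeros f : set R := [set l | l < 0 /\ f l = 0].

Section OneCurve.
Variables (U V : R -> R).
Hypothesis h : curve U V.
Local Notation F := (Robin U V).

Lemma curve_zeroV z : V z = 0 -> crossing (-1) (fun l => V l * U z) z.
Proof.
move=> Vz; have [e e0 he] := curve_turn h z; exists e => // l /he.
by rewrite Vz; congr (0 < _); ring.
Qed.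

Lemma curve_zeroU z : U z = 0 -> crossing 1 (fun l => U l * V z) z.
Proof.
move=> Uz; have [e e0 he] := curve_turn h z; exists e => // l /he.
by rewrite Uz; congr (0 < _); ring.
Qed.

Lemma curve_neq0 z : V z = 0 -> U z = 0 -> False.
Proof.
move=> Vz Uz; have [e e0 he] := curve_turn h z.
have := he (z + e / 2); rewrite addrAC subrr add0r gtr0_norm; last by lra.
have -> : 0 < e / 2 < e by apply/andP; split; lra.
by move=> /(_ isT); rewrite Vz Uz !mulr0 subrr mulr0 ltxx.
Qed.

(** From [V z = - kappa z * U z] one gets [F l * U z = - (U l * V z - V l * U z) + (kappa l - kappa
    z) * U l * U z]. Times [l - z], both terms are negative near [z]: the first because the curve
    turns, the second because [kappa] decreases and [U l] has the sign of [U z]. *)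
Lemma curve_zeroF z : z < 0 -> F z = 0 -> crossing (-1) (fun l => F l * U z) z.
Proof.
move=> z0 Fz; have Vz : V z = - kappa z * U z by rewrite mulNr; apply/eqP; rewrite -addr_eq0 -Fz.
have Uz : U z != 0.
  by apply/eqP => Uz; apply: (@curve_neq0 z) => //; rewrite Vz Uz mulr0.
have [e e0 he] := curve_turn h z.
have UU : 0 < U z * U z by rewrite -expr2 exprn_even_gt0.
have [e' e'0 he'] := continuous_pos_near (contM (@cont_cst _ (U z)) (curve_contU h)) UU.
exists (Num.min e e'); first by rewrite lt_min e0.
move=> l /andP[l0]; rewrite lt_min => /andP[le le'].
have h1 : 0 < (l - z) * (U l * V z - V l * U z) by apply: he; rewrite l0.
have h2 := he' _ le'.
have lz : l != z by rewrite -subr_eq0 -normr_gt0.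
have h3 := kappa_decr z0 lz.
have : (l - z) * (kappa l - kappa z) * (U z * U l) < 0 by rewrite pmulr_llt0.
rewrite /Robin; rewrite Vz in h1; nra.
Qed.

(** At a zero of [V] the factor [F] is [kappa U], so the fall of [V l * U z] carries over. At a zero
    of [F] the factor [V] is [- kappa U], and the minus sign turns a fall into a rise. *)
Lemma alternating_VF : exists l0,
  alternating (fun l => V l * F l) (negative_zeros V) (negative_zeros F) l0.
Proof.
have [l0 hl] := curve_pos h; have cF := Robin_cont h.
have cU := curve_contU h; have cV := curve_contV h.
exists l0; split.
- exact: contM.
- by move=> z [] [].
- by move=> z z0 /eqP; rewrite mulf_eq0 => /orP[] /eqP e; [left|right].
- move=> z [z0 Vz]; apply: (crossing_mul cF _ (curve_zeroV Vz)).
  rewrite /Robin Vz add0r mulrCA mulr_gt0 ?kappa_gt0// -expr2 exprn_even_gt0//=.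
  by apply/eqP => Uz; exact: curve_neq0 Vz Uz.
- move=> z [z0 Fz].
  have -> : (fun l => V l * F l) = (fun l => F l * V l) by apply/funext => l; rewrite mulrC.
  rewrite -[1]opprK; apply: crossingN.
  have -> : (fun l => - (F l * V l)) = (fun l => F l * - V l) by apply/funext => l; rewrite mulrN.
  apply: (crossing_mul (contN cV) _ (curve_zeroF z0 Fz)).
  have Vz : V z = - kappa z * U z by rewrite mulNr; apply/eqP; rewrite -addr_eq0 -Fz.
  rewrite Vz mulNr opprK mulrCA mulr_gt0 ?kappa_gt0// -expr2 exprn_even_gt0//=.
  by apply/eqP => Uz; apply: (@curve_neq0 z) => //; rewrite Vz Uz mulr0.
- move=> x /hl[Ux Vx]; rewrite mulr_gt0// /Robin ltr_pwDl// mulr_ge0//; last exact: ltW.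
  exact: sqrtr_ge0.
Qed.

(** At a zero of [U] the factor [F] is [V], so [curve_zeroU] gives the rise directly. *)
Lemma alternating_FU : exists l0,
  alternating (fun l => F l * U l) (negative_zeros F) (negative_zeros U) l0.
Proof.
have [l0 hl] := curve_pos h; have cF := Robin_cont h.
have cU := curve_contU h; have cV := curve_contV h.
exists l0; split.
- exact: contM.
- by move=> z [] [].
- by move=> z z0 /eqP; rewrite mulf_eq0 => /orP[] /eqP e; [left|right].
- move=> z [z0 Fz]; apply: (crossing_mul cU _ (curve_zeroF z0 Fz)).
  rewrite -expr2 exprn_even_gt0//=; apply/eqP => Uz; apply: (@curve_neq0 z) => //.
  by move: Fz; rewrite /Robin Uz mulr0 addr0.
- move=> z [z0 Uz].
  have -> : (fun l => F l * U l) = (fun l => U l * F l) by apply/funext => l; rewrite mulrC.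
  apply: (crossing_mul cF _ (curve_zeroU Uz)).
  rewrite /Robin Uz mulr0 addr0 -expr2 exprn_even_gt0//=.
  by apply/eqP => Vz; exact: curve_neq0 Vz Uz.
- move=> x /hl[Ux Vx]; rewrite mulr_gt0// /Robin ltr_pwDl// mulr_ge0//; last exact: ltW.
  exact: sqrtr_ge0.
Qed.

(** At [l = 0] one has [F = V], which settles the case [V 0 != 0]. If [V 0 = 0], then [V U] changes
    from plus to minus at [0], and [V F = V^2 + kappa V U] is positive just left of it. *)
Lemma curve_near0 : exists2 e, 0 < e & forall l, - e < l -> l < 0 -> 0 < V l * F l.
Proof.
have cU := curve_contU h; have cV := curve_contV h.
have [V0|V0] := eqVneq (V 0) 0.
  have [|e e0 he] := crossing_mul cU _ (curve_zeroV V0).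
    by rewrite -expr2 exprn_even_gt0//=; apply/eqP => U0; exact: curve_neq0 V0 U0.
  exists e => // l el l0; have := he l; rewrite subr0 ltr0_norm//.
  have -> : 0 < - l < e by apply/andP; split; lra.
  move=> /(_ isT); rewrite mulN1r => hh.
  have VU : 0 < V l * U l by rewrite -(pmulr_rgt0 _ (_ : 0 < - l)) ?oppr_gt0.
  have := kappa_gt0 l0; rewrite /Robin => k0.
  have V2 := sqr_ge0 (V l); have := mulr_gt0 k0 VU; rewrite mulrDr -expr2; nra.
have F0 : F 0 = V 0 by rewrite /Robin /kappa oppr0 sqrtr0 mul0r addr0.
have VF : 0 < V 0 * F 0 by rewrite F0 -expr2 exprn_even_gt0.
have [e e0 he] := continuous_pos_near (contM cV (Robin_cont h)) VF.
by exists e => // l el l0; apply: he; rewrite subr0 ltr0_norm//; lra.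
Qed.

End OneCurve.

(** At a zero of the first Robin function [V = - kappa U], so [U] times the second one is
    [U V' - V U' = 1]; at a zero of the second, [- U'] times the first is [1] as well. The sign of
    the Wronskian thus decides which family starts. *)
Lemma alternating_FF U V U' V' : curve U V -> curve U' V' ->
  (forall l, U l * V' l - V l * U' l = 1) ->
  exists l0, alternating (fun l => Robin U V l * Robin U' V' l)
    (negative_zeros (Robin U V)) (negative_zeros (Robin U' V')) l0.
Proof.
move=> h h' W; have [l1 hl1] := curve_pos h; have [l2 hl2] := curve_pos h'.
have cF := Robin_cont h; have cF' := Robin_cont h'.
have k0 x : 0 <= kappa x by exact: sqrtr_ge0.
exists (Num.min l1 l2); split.
- exact: contM.
- by move=> z [] [].
- by move=> z z0 /eqP; rewrite mulf_eq0 => /orP[] /eqP e; [left|right].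
- move=> z [z0 Fz]; apply: (crossing_mul cF' _ (curve_zeroF h z0 Fz)).
  have -> : U z * Robin U' V' z = 1; last by [].
  have Vz : V z = - kappa z * U z by rewrite mulNr; apply/eqP; rewrite -addr_eq0 -Fz.
  by rewrite -[RHS](W z) Vz /Robin; ring.
- move=> z [z0 Fz].
  have -> : (fun l => Robin U V l * Robin U' V' l) = (fun l => Robin U' V' l * Robin U V l).
    by apply/funext => l; rewrite mulrC.
  rewrite -[1]opprK; apply: crossingN.
  have -> : (fun l => - (Robin U' V' l * Robin U V l)) = (fun l => Robin U' V' l * - Robin U V l).
    by apply/funext => l; rewrite mulrN.
  apply: (crossing_mul (contN cF) _ (curve_zeroF h' z0 Fz)).
  have -> : U' z * - Robin U V z = 1; last by [].
  have Vz : V' z = - kappa z * U' z by rewrite mulNr; apply/eqP; rewrite -addr_eq0 -Fz.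
  by rewrite -[RHS](W z) Vz /Robin; ring.
- move=> x; rewrite le_min => /andP[/hl1[U1 V1] /hl2[U2 V2]].
  by rewrite mulr_gt0// /Robin ltr_pwDl// mulr_ge0// ltW.
Qed.

End SpectralCurve.

(** * Dependence on the spectral parameter *)

Section MeanValue.
Context {R : realType}.
Implicit Types (f g : R -> R).

Lemma mean_value f g (a b : R) : a < b -> continuous f ->
  (forall x, a < x -> x < b -> is_derive x 1 f (g x)) ->
  exists c, [/\ a < c, c < b & f b - f a = g c * (b - a)].
Proof.
move=> ab cf df; have [||c] := @MVT R f g a b ab.
- by move=> x; rewrite in_itv/= => /andP[]; exact: df.
- exact: continuous_subspaceT.
by rewrite in_itv/= => /andP[ac cb] E; exists c.
Qed.

Lemma is_derive_ext f f' (x d d' : R) : is_derive x 1 f d -> f = f' -> d = d' -> is_derive x 1 f' d'.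
Proof. by move=> ? <- <-. Qed.

Lemma is_derive_mul f g (x df dg : R) : is_derive x 1 f df -> is_derive x 1 g dg ->
  is_derive x 1 (fun t => f t * g t) (df * g x + f x * dg).
Proof.
move=> hf hg; apply: (is_derive_ext (is_deriveM hf hg)) => //.
by rewrite /GRing.scale /=; ring.
Qed.

Lemma is_derive_add f g (x df dg : R) : is_derive x 1 f df -> is_derive x 1 g dg ->
  is_derive x 1 (fun t => f t + g t) (df + dg).
Proof. by move=> hf hg; apply: (is_derive_ext (is_deriveD hf hg)). Qed.

Lemma is_derive_opp f (x df : R) : is_derive x 1 f df -> is_derive x 1 (fun t => - f t) (- df).
Proof. by move=> hf; apply: (is_derive_ext (is_deriveN hf)). Qed.

Lemma is_derive_scale f (k x df : R) : is_derive x 1 f df -> is_derive x 1 (fun t => k * f t) (k * df).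
Proof. by move=> hf; apply: (is_derive_ext (is_deriveZ k hf)). Qed.

Lemma is_derive_var (x : R) : is_derive x 1 (fun t : R => t) (1 : R).
Proof. exact: is_derive_id. Qed.

Lemma zero_is_derive f (a b x d : R) : a < x -> x < b -> (forall t, a < t -> t < b -> f t = 0) ->
  is_derive x 1 f d -> d = 0.
Proof.
move=> ax xb f0 df; rewrite -(@derive_val _ _ _ _ _ _ _ df).
rewrite -derive1E -(@derive1_cst R R 0 x) !derive1E.
apply: near_eq_derive.
near=> t; rewrite /= f0//; near: t.
- exact: lt_nbhsr.
- exact: lt_nbhsl.
Unshelve. all: by end_near. Qed.

Lemma continuous_eq0 f (a b x : R) : continuous f -> a < b -> a <= x <= b ->
  (forall t, a < t -> t < b -> f t = 0) -> f x = 0.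
Proof.
move=> cf ab /andP[ax xb] f0; apply/eqP; rewrite -normr_le0 leNgt; apply/negP => fx.
have cfn : continuous (fun t => `|f t|).
  by move=> t; apply: (@continuous_comp _ _ _ f Num.norm); [exact: cf|exact: norm_continuous].
have [e e0 he] := continuous_pos_near cfn fx.
have [m [m0 m1 m2]] : exists m, [/\ 0 < m, m <= e & m <= b - a].
  exists (Num.min e (b - a)); split; first by rewrite lt_min e0 subr_gt0.
    by rewrite ge_min lexx.
  by rewrite ge_min lexx orbT.
have [t [at_ tb tx]] : exists t, [/\ a < t, t < b & `|t - x| < e].
  have [h|h] := ltP x ((a + b) / 2).
    exists (x + m / 4); split; [lra|lra|].
    by rewrite addrAC subrr add0r gtr0_norm; lra.
  exists (x - m / 4); split; [lra|lra|].
  by rewrite addrAC subrr add0r normrN gtr0_norm; lra.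
by have := he t tx; rewrite f0// normr0 ltxx.
Qed.

Lemma pos_end f : continuous f -> 0 < f 0 -> (forall x, 0 < x -> x <= 1 -> f x != 0) -> 0 < f 1.
Proof.
move=> cf f0 fn; rewrite lt_neqAle eq_sym fn//= leNgt; apply/negP => f1.
have [||x] := @IVT R f 0 1 0 ler01.
- exact: continuous_subspaceT.
- by rewrite ge_min (ltW f1) orbT le_max (ltW f0).
rewrite in_itv/= => /andP[x0 x1] fx.
have xp : 0 < x by rewrite lt_neqAle x0 andbT; apply/eqP => E; move: f0; rewrite [X in f X]E fx ltxx.
by have := fn x xp x1; rewrite fx eqxx.
Qed.

End MeanValue.

Section Dependence.
Context {R : realType}.
Local Notation mu := (@lebesgue_measure R).
Variables (Q : R -> R) (B : R).
Hypotheses (cQ : continuous Q) (bQ : forall x, `|Q x| <= B) (Q0 : Q 0 = 0).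

(** The terms in [Q] cancel, and the quasi-derivatives give the same determinant as the
    derivatives. *)
Lemma wronskian_derive l m u w u' w' (x : R) : solution Q l u w -> solution Q m u' w' -> 0 < x ->
  is_derive x 1 (fun t => u t * w' t - w t * u' t) ((l - m) * (u x * u' x)).
Proof.
move=> s s' x0; have [du dw] := solution_is_derive cQ s x0.
have [du' dw'] := solution_is_derive cQ s' x0.
apply: (is_derive_ext (is_derive_add (is_derive_mul du dw') (is_derive_opp (is_derive_mul dw du')))) => //.
by rewrite /vel /acc; ring.
Qed.

Lemma wronskian_cont l m u w u' w' : solution Q l u w -> solution Q m u' w' ->
  continuous (fun t => u t * w' t - w t * u' t).
Proof.
move=> s s'; have [cu cw _ _] := s; have [cu' cw' _ _] := s'.
by apply: contB; exact: contM.
Qed.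

Lemma wronskian_const l u w u' w' x : solution Q l u w -> solution Q l u' w' -> 0 <= x ->
  u x * w' x - w x * u' x = u 0 * w' 0 - w 0 * u' 0.
Proof.
move=> s s'; rewrite le_eqVlt => /predU1P[<-//|x0].
have [|c [_ _]] := mean_value x0 (wronskian_cont s s') (g := fun t => (l - l) * (u t * u' t)).
  by move=> t t0 _; exact: wronskian_derive.
by rewrite subrr !mul0r => /subr0_eq.
Qed.

(** Aimed at [x = 1]: since [Q 1 >= - B], the bound gives [u (w + Q 1 u) > 0] there, and the factor
    [x] keeps the correction zero at the start. In the derivative, after completing the square, the
    coefficient of [u^2] is [- l - Q^2 - B - 2 B c Q - (B c)^2]; the threshold [4 B^2 + B + 1] makes
    it at least [1]. *)
Lemma solution_pos l u w : solution Q l u w -> u 0 * w 0 = 0 ->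
  (forall x, 0 <= x -> u x = 0 -> w x = 0 -> False) ->
  l <= - (4 * B ^+ 2 + B + 1) ->
  forall x, 0 < x -> x <= 1 -> 0 < u x * w x - B * x * (u x * u x).
Proof.
move=> s uw0 nz ll x x0 x1; have [cu cw _ _] := s.
have B0 := bound_ge0 bQ.
(* [G] vanishes at [0] and its derivative is a positive definite form in [(u, w)]. *)
pose G t := u t * w t + - (B * (t * (u t * u t))).
have cG : continuous G.
  apply: contD; first exact: contM.
  by apply: contN; apply: contM; [exact: cont_cst|apply: contM; [exact: cont_id|exact: contM]].
pose G' t := vel Q u w t * w t + u t * acc Q l u w t
   + - (B * (1 * (u t * u t) + t * (vel Q u w t * u t + u t * vel Q u w t))).
have [|c [c0 cx]] := mean_value x0 cG (g := G').
  move=> t t0 _; have [du dw] := solution_is_derive cQ s t0.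
  apply: is_derive_add; first exact: is_derive_mul.
  apply: is_derive_opp; apply: is_derive_scale; apply: is_derive_mul; last exact: is_derive_mul.
have -> : u x * w x - B * x * (u x * u x) = G x - G 0 by rewrite /G uw0; ring.
move=> ->; rewrite subr0 mulr_gt0//.
have -> : G' c = (w c - B * c * u c) ^+ 2 + (- l - Q c ^+ 2 - B - 2 * B * c * Q c - (B * c) ^+ 2) * u c ^+ 2.
  by rewrite /G' /vel /acc; ring.
have c1 : c < 1 by exact: lt_le_trans x1.
have Qc := bQ c; rewrite ler_norml in Qc; have /andP[Q1 Q2] := Qc.
have coef : 1 <= - l - Q c ^+ 2 - B - 2 * B * c * Q c - (B * c) ^+ 2.
  have h1 : Q c ^+ 2 <= B ^+ 2 by nra.
  have Bc : 0 <= B * c <= B by apply/andP; split; nra.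
  have /andP[Bc0 BcB] := Bc.
  have h2 : (B * c) ^+ 2 <= B ^+ 2 by nra.
  have h3 : (B * c) * Q c <= B ^+ 2 by nra.
  have -> : 2 * B * c * Q c = 2 * ((B * c) * Q c) by ring.
  lra.
have [u_0|un0] := eqVneq (u c) 0.
  rewrite u_0 mulr0 subr0 expr0n/= mulr0 addr0 exprn_even_gt0//=.
  by apply/eqP => w_0; exact: nz (ltW c0) u_0 w_0.
have u2 : 0 < u c ^+ 2 by rewrite exprn_even_gt0.
have := sqr_ge0 (w c - B * c * u c); nra.
Qed.

(** The differential inequality for [a^2 + b^2], where [(a, b)] is the difference of two solutions,
    [d] that of the parameters and [y] the reference solution. In the constant, [2 B] comes from the
    terms in [q], the bracket bounds [|1 - l - q^2|], and the last [1] comes from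
    [- 2 b d y <= b^2 + (d y)^2]. *)
Let lipschitz_aux (l l0 a b b' a' q d y : R) : `|l - l0| <= 1 -> `|q| <= B ->
  a' = q * a + b -> b' = - (l + q ^+ 2) * a - q * b - d * y ->
  a' * a + a * a' + (b' * b + b * b') <=
  (2 * B + (2 + `|l0| + B ^+ 2) + 1) * (a * a + b * b) + d ^+ 2 * (y * y).
Proof.
move=> ll qB -> ->; have B0 := bound_ge0 bQ.
have q2 : `|q ^+ 2| <= B ^+ 2 by rewrite normrX lerXn2r ?nnegrE.
have e1 : `|1 - l - q ^+ 2| <= 2 + `|l0| + B ^+ 2.
  have -> : 1 - l - q ^+ 2 = 1 - (l - l0) - l0 - q ^+ 2 by ring.
  apply: (le_trans (ler_normB _ _)); apply: lerD => //.
  apply: (le_trans (ler_normB _ _)); apply: lerD => //.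
  by apply: (le_trans (ler_normB _ _)); rewrite normr1; lra.
have S0 : 0 <= a * a + b * b by rewrite addr_ge0// -expr2 sqr_ge0.
have a2 : 0 <= a * a by rewrite -expr2 sqr_ge0.
have b2 : 0 <= b * b by rewrite -expr2 sqr_ge0.
have h1 : 2 * a * b * (1 - l - q ^+ 2) <= (2 + `|l0| + B ^+ 2) * (a * a + b * b).
  apply: (le_trans (ler_norm _)); rewrite normrM mulrC ler_pM//.
  have := sqr_ge0 (a - b); have := sqr_ge0 (a + b) => s1 s2.
  by rewrite ler_norml; apply/andP; split; lra.
have h2 : 2 * q * (a * a - b * b) <= 2 * B * (a * a + b * b).
  move: qB; rewrite ler_norml => /andP[qB1 qB2]; nra.
have h3 := sqr_ge0 (b + d * y).
have -> : (q * a + b) * a + a * (q * a + b) + ((- (l + q ^+ 2) * a - q * b - d * y) * b +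
   b * (- (l + q ^+ 2) * a - q * b - d * y)) =
  2 * q * (a * a - b * b) + 2 * a * b * (1 - l - q ^+ 2) - 2 * b * (d * y) by ring.
have -> : d ^+ 2 * (y * y) = (d * y) ^+ 2 by ring.
move: h1 h2 h3; set X := d * y; lra.
Qed.

Lemma solution_lipschitz l0 u0 w0 : solution Q l0 u0 w0 ->
  exists2 c, 0 < c & forall l u w, `|l - l0| <= 1 -> solution Q l u w -> u 0 = u0 0 -> w 0 = w0 0 ->
    forall x, 0 <= x -> x <= 1 -> `|u x - u0 x| <= c * `|l - l0| /\ `|w x - w0 x| <= c * `|l - l0|.
Proof.
move=> s0; have [cu0 cw0 _ _] := s0; have B0 := bound_ge0 bQ.
have [M M0 hM] : exists2 M : R, 0 <= M & forall x, 0 <= x -> x <= 1 -> u0 x * u0 x <= M.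
  have [K _ HK] := EVT_max ler01 (continuous_subspaceT (contM cu0 cu0)).
  exists (u0 K * u0 K); first by rewrite -expr2 sqr_ge0.
  by move=> x x0 x1; apply: HK; rewrite in_itv/= x0.
pose K := 2 * B + (2 + `|l0| + B ^+ 2) + 1.
have K0 : 0 <= K by rewrite /K; have := normr_ge0 l0; have := sqr_ge0 B; lra.
(* The Gronwall bound is [(l - l0)^2 * y] with [y = M * expR K]; taking [c = y + 1] avoids a square
   root, as [y <= (y + 1)^2]. *)
pose c := M * expR K + 1; have eK := expR_gt0 K.
have c0 : 0 < c by rewrite /c ltr_wpDl// mulr_ge0// ltW.
exists c => // l u w ll s uu ww x x0 x1.
have [cu cw _ _] := s.
pose du t := u t + - u0 t; pose dw t := w t + - w0 t.
pose d := l - l0.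
have cdu : continuous du by exact: contB.
have cdw : continuous dw by exact: contB.
pose E t := du t * du t + dw t * dw t.
pose ex t : R := expR (- (K * t)).
(* Gronwall: [E' <= K E + d^2 M] makes [H] nonincreasing. *)
pose H t := E t * ex t + - (d ^+ 2 * M * t).
have cex : continuous ex.
  move=> t; apply: (@continuous_comp _ _ _ (fun t => - (K * t)) (@expR R)); last exact: continuous_expR.
  by apply: contN; apply: contM; [exact: cont_cst|exact: cont_id].
have cH : continuous H.
  apply: contD; first by apply: contM => //; apply: contD; exact: contM.
  by apply: contN; apply: contM; [exact: cont_cst|exact: cont_id].
have EH : E x <= d ^+ 2 * M * expR K.
  have Hle : H x <= 0.
    have [x0'|x_neq0] := eqVneq x 0.
      rewrite x0' /H /E /du /dw uu ww !subrr !mulr0 addr0 mul0r add0r oppr0//.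
    have xp : 0 < x by rewrite lt_neqAle eq_sym x_neq0.
    pose E' t := (vel Q u w t - vel Q u0 w0 t) * du t + du t * (vel Q u w t - vel Q u0 w0 t)
       + ((acc Q l u w t - acc Q l0 u0 w0 t) * dw t + dw t * (acc Q l u w t - acc Q l0 u0 w0 t)).
    pose H' t := E' t * ex t + E t * (- (K * 1) * ex t) + - (d ^+ 2 * M * 1).
    have [|t [t0 tx]] := mean_value xp cH (g := H').
      move=> t t0 _; have [a1 a2] := solution_is_derive cQ s t0.
      have [b1 b2] := solution_is_derive cQ s0 t0.
      have d1 := is_derive_add a1 (is_derive_opp b1).
      have d2 := is_derive_add a2 (is_derive_opp b2).
      apply: is_derive_add.
        apply: is_derive_mul.
          by apply: is_derive_add; apply: is_derive_mul.
        have := @is_derive1_comp R (@expR R) (fun t => - (K * t)) t _ _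
          (is_derive_expR (- (K * t))) (is_derive_opp (is_derive_scale K (is_derive_var t))).
        by move=> dd; apply: (is_derive_ext dd) => //; rewrite /ex mulrC.
    have -> : H 0 = 0.
      by rewrite /H /E /du /dw uu ww !subrr !mulr0 addr0 mul0r add0r oppr0.
    rewrite !subr0 => ->; rewrite pmulr_lle0//.
    have t1 : t <= 1 by apply: ltW; exact: lt_le_trans x1.
    have ex0 : 0 < ex t by exact: expR_gt0.
    have ex1 : ex t <= 1 by rewrite -expR0 ler_expR oppr_le0 mulr_ge0// ltW.
    have EE : E' t <= K * E t + d ^+ 2 * (u0 t * u0 t).
      have e1 : vel Q u w t - vel Q u0 w0 t = Q t * du t + dw t by rewrite /vel /du /dw; ring.
      have e2 : acc Q l u w t - acc Q l0 u0 w0 t =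
          - (l + Q t ^+ 2) * du t - Q t * dw t - d * u0 t by rewrite /acc /du /dw /d; ring.
      exact: (lipschitz_aux ll (bQ t) e1 e2).
    rewrite /H' mulr1 mulr1; have M' := hM t (ltW t0) t1.
    have d2 := sqr_ge0 d.
    have : (E' t - K * E t) * ex t <= d ^+ 2 * M.
      apply: (@le_trans _ _ (d ^+ 2 * (u0 t * u0 t) * ex t)).
        by rewrite ler_pM2r//; lra.
      rewrite -mulrA ler_wpM2l//; apply: le_trans M'.
      by rewrite ler_piMr// -expr2 sqr_ge0.
    lra.
  have d2M : 0 <= d ^+ 2 * M by rewrite mulr_ge0// sqr_ge0.
  have exx : ex x * expR (K * x) = 1 by rewrite /ex -expRD addNr expR0.
  have -> : E x = E x * ex x * expR (K * x) by rewrite -mulrA exx mulr1.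
  have eKx : expR (K * x) <= expR K by rewrite ler_expR ler_piMr.
  have eKx0 := expR_gt0 (K * x).
  apply: (@le_trans _ _ (d ^+ 2 * M * expR (K * x))); last by rewrite ler_wpM2l.
  rewrite ler_pM2r//; move: Hle; rewrite /H.
  have : d ^+ 2 * M * x <= d ^+ 2 * M by rewrite ler_piMr.
  lra.
have Ec : E x <= (c * `|l - l0|) ^+ 2.
  apply: (le_trans EH); rewrite exprMn real_normK ?num_real// -/d mulrAC [_ * d ^+ 2]mulrC -mulrA.
  rewrite ler_wpM2l ?sqr_ge0// mulrC /c; set y := M * expR K.
  have y0 : 0 <= y by rewrite mulr_ge0// ltW.
  nra.
have cl : 0 <= c * `|l - l0| by rewrite mulr_ge0// ltW.
have bd (y : R) : y ^+ 2 <= (c * `|l - l0|) ^+ 2 -> `|y| <= c * `|l - l0|.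
  by move=> yy; rewrite -(@ler_pXn2r _ 2)// ?nnegrE// real_normK ?num_real.
split; apply: bd; apply: le_trans Ec; rewrite /E /du /dw.
  by rewrite expr2 lerDl -expr2 sqr_ge0.
by rewrite expr2 lerDr -expr2 sqr_ge0.
Qed.

(** The comparison solution has the initial data turned by a right angle, so that the constant
    Wronskian is [u 0 ^+ 2 + w 0 ^+ 2]; a common zero would make it vanish. *)
Lemma solution_neq0 l u w x : solution Q l u w -> (u 0 != 0) || (w 0 != 0) ->
  0 <= x -> u x = 0 -> w x = 0 -> False.
Proof.
move=> s nz x0 ux wx; have [u' [w' [s' u'0 w'0]]] := solution_exists cQ bQ l (- w 0) (u 0).
have := wronskian_const s s' x0; rewrite ux wx !mul0r subrr u'0 w'0 mulrN opprK => /esym/eqP.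
rewrite -!expr2 paddr_eq0 ?sqr_ge0// !sqrf_eq0 => /andP[/eqP u0 /eqP w0].
by move: nz; rewrite u0 w0 !eqxx.
Qed.

Lemma solution_eq0 l u w : solution Q l u w -> (forall x, 0 < x -> x < 1 -> u x = 0) ->
  u 0 = 0 /\ w 0 = 0.
Proof.
move=> s uz; have [cu cw _ _] := s.
have wz x : 0 < x -> x < 1 -> w x = 0.
  move=> x0 x1; have [du _] := solution_is_derive cQ s x0.
  by have := zero_is_derive x0 x1 uz du; rewrite /vel uz// mulr0 add0r.
by split; [apply: (continuous_eq0 cu ltr01 _ uz)|apply: (continuous_eq0 cw ltr01 _ wz)];
  rewrite lexx ler01.
Qed.

(** The integral is nondecreasing in its end point; were it [0] at [1], it would vanish on [[0, 1]],
    and so would its derivative [u^2] inside. *)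
Lemma solution_sqr_int l u w : solution Q l u w -> (u 0 != 0) || (w 0 != 0) ->
  0 < integral0 (fun x => u x * u x) 1.
Proof.
move=> s nz; have [cu cw _ _] := s; have cuu := contM cu cu.
have iuu := continuous_integrable_segment cuu.
have cJ := integral0_continuous iuu; have P := integral0_primitive iuu.
have mono x y : 0 <= x -> x <= y -> integral0 (fun x => u x * u x) x <= integral0 (fun x => u x * u x) y.
  move=> x0 xy; rewrite -subr_ge0.
  have Ix : `[0, +oo[%classic x by rewrite /= in_itv/= x0.
  have Iy : `[0, +oo[%classic y by rewrite /= in_itv/= (le_trans x0).
  have [_ ->] := P x y Ix Iy xy.
  by apply: Rintegral_ge0 => t _; rewrite -expr2 sqr_ge0.
have J0 : integral0 (fun x => u x * u x) 0 = 0 by rewrite integral0_le0.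
have := mono 0 1 (lexx 0) ler01; rewrite J0 le_eqVlt => /predU1P[E|//].
have Jz t : 0 < t -> t < 1 -> integral0 (fun x => u x * u x) t = 0.
  move=> t0 t1; apply/eqP; rewrite eq_le; apply/andP; split.
    by rewrite E; apply: mono; exact: ltW.
  by rewrite -[leLHS]J0; apply: mono => //; exact: ltW.
have uz x : 0 < x -> x < 1 -> u x = 0.
  move=> x0 x1; have := zero_is_derive x0 x1 Jz (integral0_is_derive iuu (cuu x) x0).
  by move=> /eqP; rewrite mulf_eq0 orbb => /eqP.
by have [u0 w0] := solution_eq0 s uz; move: nz; rewrite u0 w0 !eqxx.
Qed.

Variables (u w : R -> R -> R) (a0 b0 : R).
Hypotheses (us : forall l, solution Q l (u l) (w l))
  (u0 : forall l, u l 0 = a0) (w0 : forall l, w l 0 = b0).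
Hypothesis ab : (a0 = 1 /\ b0 = 0) \/ (a0 = 0 /\ b0 = 1).

Let nz l : (u l 0 != 0) || (w l 0 != 0).
Proof. by rewrite u0 w0; case: ab => -[-> ->]; rewrite oner_eq0 ?orbT. Qed.

Lemma solution_end_cont : continuous (fun l => u l 1) /\ continuous (fun l => w l 1).
Proof.
suff lip (f : R -> R) (z : R) c : 0 < c -> (forall l, `|l - z| <= 1 -> `|f l - f z| <= c * `|l - z|) ->
    {for z, continuous f}.
  split=> z; have [c c0 hc] := solution_lipschitz (us z); apply: (lip _ _ c) => // l lz;
    by have [] := hc l _ _ lz (us l) (etrans (u0 l) (esym (u0 z)))
      (etrans (w0 l) (esym (w0 z))) 1 ler01 (lexx 1).
move=> c0 hf; apply/cvgrPdist_lt => e e0; apply/nbhs_ballP.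
exists (Num.min 1 (e / c)) => /=; first by rewrite lt_min ltr01 divr_gt0.
move=> l /=; rewrite /ball/= lt_min => /andP[l1 le]; rewrite distrC in l1 le.
by rewrite distrC; apply: (le_lt_trans (hf l (ltW l1))); rewrite mulrC -ltr_pdivlMr.
Qed.

Lemma solution_curve : curve (fun l => u l 1) (fun l => w l 1 + Q 1 * u l 1).
Proof.
have [cU cW] := solution_end_cont; split=> //.
- by apply: contD => //; apply: contM => //; exact: cont_cst.
- move=> z; have [c c0 hc] := solution_lipschitz (us z).
  have [cu cw _ _] := us z; have cuu := contM cu cu.
  have iuu := continuous_integrable_segment cuu.
  have cJ := integral0_continuous iuu.
  have I1 := solution_sqr_int (us z) (nz z); set K := integral0 _ 1 in I1.
  have [m m0 hm] : exists2 m : R, 0 < m & forall x, 0 <= x -> x <= 1 -> `|u z x| <= m.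
    have cn : continuous (fun x => `|u z x|).
      by move=> t; apply: (@continuous_comp _ _ _ (u z) Num.norm); [exact: cu|exact: norm_continuous].
    have [M _ HM] := EVT_max ler01 (continuous_subspaceT cn).
    exists (`|u z M| + 1); first by rewrite ltr_wpDl.
    move=> x x0 x1; apply: (@le_trans _ _ `|u z M|); last by rewrite lerDl.
    by apply: HM; rewrite in_itv/= x0.
  have mc : 0 < m * c by rewrite mulr_gt0.
  (* The error in the Wronskian is at most [m c |l - z|^2], which is below the main term [K |l - z|]
     within this radius; the [1] is the range of the Lipschitz bound. *)
  exists (Num.min 1 (K / (m * c))); first by rewrite lt_min ltr01 divr_gt0.
  move=> l /andP[lz]; rewrite lt_min => /andP[l1 lK].
  have H := hc l _ _ (ltW l1) (us l) (etrans (u0 l) (esym (u0 z))) (etrans (w0 l) (esym (w0 z))).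
  (* The Wronskian at [1] is [(l - z) int_0^1 u_l u_z], close to [(l - z) int_0^1 u_z^2]. *)
  pose D t := (u l t * w z t - w l t * u z t) + - ((l - z) * integral0 (fun x => u z x * u z x) t).
  have cD : continuous D.
    apply: contD; first exact: wronskian_cont (us l) (us z).
    by apply: contN; apply: contM => //; exact: cont_cst.
  have [|x [x0 x1]] := mean_value ltr01 cD
      (g := fun x => (l - z) * (u l x * u z x) + - ((l - z) * (u z x * u z x))).
    move=> t t0 _; apply: is_derive_add; first exact: wronskian_derive (us l) (us z) t0.
    exact: (is_derive_opp (is_derive_scale _ (integral0_is_derive iuu (cuu t) t0))).
  have -> : D 0 = 0 by rewrite /D integral0_le0// u0 w0 u0 w0; ring.
  rewrite !subr0 mulr1 => E.
  have [Hx _] := H x (ltW x0) (ltW x1).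
  have D1 : `|D 1| <= `|l - z| * (m * (c * `|l - z|)).
    have -> : D 1 = (l - z) * (u z x * (u l x - u z x)) by rewrite E; ring.
    rewrite normrM ler_wpM2l// normrM ler_pM//; exact: hm (ltW x0) (ltW x1).
  have -> : u l 1 * (w z 1 + Q 1 * u z 1) - (w l 1 + Q 1 * u l 1) * u z 1 = D 1 + (l - z) * K.
    by rewrite /D -/K; ring.
  rewrite mulrDr mulrA -expr2 -(@real_normK _ (l - z)) ?num_real//.
  have h1 : - (`|l - z| * `|D 1|) <= (l - z) * D 1.
    by rewrite -normrM; have := ler_norm (- ((l - z) * D 1)); rewrite normrN; lra.
  have h2 : `|l - z| * `|D 1| <= `|l - z| * (`|l - z| * (m * (c * `|l - z|))) by rewrite ler_wpM2l.
  have h3 : `|l - z| ^+ 2 * (m * c * `|l - z|) < `|l - z| ^+ 2 * K.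
    by rewrite ltr_pM2l ?exprn_gt0// mulrC -ltr_pdivlMr.
  have E2 : `|l - z| * (`|l - z| * (m * (c * `|l - z|))) = `|l - z| ^+ 2 * (m * c * `|l - z|) by ring.
  rewrite E2 in h2; lra.
- exists (- (4 * B ^+ 2 + B + 1)) => l ll; have [cu cw _ _] := us l.
  have B0 := bound_ge0 bQ.
  have uw0 : u l 0 * w l 0 = 0 by rewrite u0 w0; case: ab => -[-> ->]; rewrite ?mul0r ?mulr0.
  have H := solution_pos (us l) uw0 (fun x x0 => solution_neq0 (us l) (nz l) x0) ll.
  have uw x : 0 < x -> x <= 1 -> 0 < u l x * w l x.
    move=> x0 x1; have := H x x0 x1; have : 0 <= B * x * (u l x * u l x).
      by apply: mulr_ge0; [rewrite mulr_ge0// ltW|rewrite -expr2 sqr_ge0].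
    lra.
  have U1 : 0 < u l 1.
    have uw1 := uw 1 ltr01 (lexx 1).
    (* As [u w] has no zero on [(0, 1]], the component that starts at [1] stays positive, and the
       sign of the product settles the other one. *)
    case: ab => -[ea eb].
      apply: (pos_end cu); first by rewrite u0 ea.
      by move=> x x0 x1; apply/eqP => E; have := uw x x0 x1; rewrite E mul0r ltxx.
    rewrite -(pmulr_lgt0 _ (_ : 0 < w l 1))//.
    apply: (pos_end cw); first by rewrite w0 eb.
    by move=> x x0 x1; apply/eqP => E; have := uw x x0 x1; rewrite E mulr0 ltxx.
  split=> //; rewrite -(pmulr_rgt0 _ U1) mulrDr.
  have := H 1 ltr01 (lexx 1); rewrite mulr1.
  have Q1 := bQ 1; rewrite ler_norml in Q1; have /andP[Q11 _] := Q1.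
  have u2 : 0 < u l 1 * u l 1 by rewrite mulr_gt0.
  have : - B * (u l 1 * u l 1) <= Q 1 * (u l 1 * u l 1) by rewrite ler_pM2r.
  have -> : u l 1 * (Q 1 * u l 1) = Q 1 * (u l 1 * u l 1) by ring.
  lra.
Qed.

End Dependence.

(** * Reduction of the operators to the system *)

Section RealParts.
Local Open Scope complex_scope.
Context {R : realType}.
Local Notation mu := (@lebesgue_measure R).
Implicit Types (I : set R) (p : R -> R) (l : R).

Definition real_solution_on I p l (f f1 : R -> R) := exists f2 : R -> R,
  [/\ primitive_on I f f1, primitive_on I f1 f2 & ae_on I f2 (fun x => (p x - l) * f x)].

Definition re (f : R -> R[i]) (x : R) : R := complex.Re (f x).
Definition im (f : R -> R[i]) (x : R) : R := complex.Im (f x).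
Definition toC (f : R -> R) (x : R) : R[i] := (f x)%:C.

Lemma ReB (z z' : R[i]) : complex.Re (z - z') = complex.Re z - complex.Re z'.
Proof. by case: z => a b; case: z'. Qed.

Lemma ImB (z z' : R[i]) : complex.Im (z - z') = complex.Im z - complex.Im z'.
Proof. by case: z => a b; case: z'. Qed.

Lemma ac_deriv_re I f g : ac_deriv I f g -> primitive_on I (re f) (re g).
Proof.
move=> H a b Ia Ib ab; have [[ig _] e] := H a b Ia Ib ab; split=> //.
by rewrite /re -ReB e.
Qed.

Lemma ac_deriv_im I f g : ac_deriv I f g -> primitive_on I (im f) (im g).
Proof.
move=> H a b Ia Ib ab; have [[_ ig] e] := H a b Ia Ib ab; split=> //.
by rewrite /im -ImB e.
Qed.

Lemma ac_deriv_toC I f g : primitive_on I f g -> ac_deriv I (toC f) (toC g).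
Proof.
move=> H a b Ia Ib ab; have [ig e] := H a b Ia Ib ab; split.
  split=> //=; apply: eq_integrable (integrable0 _ _) => //.
rewrite /toC /cintegral /= -e Rintegral_cst// mul0r.
by rewrite -raddfB.
Qed.

Lemma sq_integrable_re I f : measurable (I : set (measurableTypeR R)) -> sq_integrable I f ->
  mu.-integrable I (EFin \o (fun x => re f x ^+ 2)) /\
  mu.-integrable I (EFin \o (fun x => im f x ^+ 2)).
Proof.
move=> mI [mre mim ig]; split; apply: le_integrable ig => //.
- by apply/measurable_EFinP; exact: measurable_funX.
- by move=> x _ /=; rewrite lee_fin !ger0_norm ?addr_ge0 ?sqr_ge0// lerDl sqr_ge0.
- by apply/measurable_EFinP; exact: measurable_funX.
- by move=> x _ /=; rewrite lee_fin !ger0_norm ?addr_ge0 ?sqr_ge0// lerDr sqr_ge0.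
Qed.

Lemma schroedinger_real I bc p l f :
  Defs.eigenspace (schroedinger I bc p) l f -> exists f1, [/\ bc f f1,
    real_solution_on I p l (re f) (re f1) & real_solution_on I p l (im f) (im f1)].
Proof.
case=> _ _ [f1 [f2 [h1 h2 hb ae]]]; exists f1; split=> //.
- exists (re f2); split; [exact: ac_deriv_re|exact: ac_deriv_re|].
  move: ae; apply: filterS; first exact: (ae_filter_ringOfSetsType mu).
  move=> x /= H /H; rewrite /re; case: (f x) => a b; case: (f2 x) => c d /= /(congr1 (@complex.Re R)) /=.
  rewrite !mul0r !subr0 => E; lra.
- exists (im f2); split; [exact: ac_deriv_im|exact: ac_deriv_im|].
  move: ae; apply: filterS; first exact: (ae_filter_ringOfSetsType mu).
  move=> x /= H /H; rewrite /im; case: (f x) => a b; case: (f2 x) => c d /= /(congr1 (@complex.Im R)) /=.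
  rewrite !mul0r !addr0 => E; lra.
Qed.

Lemma schroedinger_toC I (bc : (R -> R[i]) -> (R -> R[i]) -> Prop) p l (f f1 : R -> R) :
  measurable (I : set (measurableTypeR R)) -> measurable_fun I f ->
  mu.-integrable I (EFin \o (fun x => f x ^+ 2)) ->
  real_solution_on I p l f f1 -> bc (toC f) (toC f1) ->
  Defs.eigenspace (schroedinger I bc p) l (toC f).
Proof.
move=> mI mf ff [f2 [h1 h2 ae]] hb; rewrite /Defs.eigenspace /=; split.
- split=> //=; apply: eq_integrable ff => // x _ /=.
  by rewrite expr0n /= addr0.
- have -> : (fun x => l%:C * toC f x) = toC (fun x => l * f x).
    by apply/funext => x; rewrite /toC rmorphM.
  split=> //=; first exact: measurable_funM.
  apply: eq_integrable (integrableZl mI (l ^+ 2) ff) => // x _ /=.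
  by rewrite expr0n /= addr0 exprMn.
- exists (toC f1), (toC f2); split; [exact: ac_deriv_toC|exact: ac_deriv_toC|by []|].
  move: ae; apply: filterS; first exact: (ae_filter_ringOfSetsType mu).
  move=> x /= H /H; rewrite /toC => ->.
  by rewrite -rmorphN -!rmorphM -rmorphD; congr (_%:C); ring.
Qed.

Lemma ae_eq_on0 I f : (forall x, I x -> re f x = 0) -> (forall x, I x -> im f x = 0) ->
  ae_eq_on I f (fun=> 0).
Proof.
move=> h1 h2; apply: aeW => x Ix; have := h1 x Ix; have := h2 x Ix.
by rewrite /re /im; case: (f x) => a b /= -> ->.
Qed.

(** The integral of [f] over [[0, t]] vanishes for all [t] in [(0, 1)], hence so does its derivative
    [f t]. *)
Lemma ae_zero_continuous I (f : R -> R) : continuous f -> `]0, 1[ `<=` I ->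
  ae_on I f (fun=> 0) -> forall x, 0 < x -> x < 1 -> f x = 0.
Proof.
move=> cf sub ae x x0 x1; have ic := continuous_integrable_segment cf.
have Jz t : 0 < t -> t < 1 -> integral0 f t = 0.
  move=> t0 t1; have it : mu.-integrable `]0, t] (EFin \o f).
    by apply: integrableS (ic 0 t) => //; exact: subset_itv_oc_cc.
  rewrite /integral0 -Rintegral_itv_obnd_cbnd//.
  transitivity (\int[mu]_(s in `]0, t]) (cst 0 s : R)); last by rewrite Rintegral_cst// mul0r.
  rewrite /Rintegral; congr fine; apply: ae_eq_integral => //.
  - exact: (measurable_int _ it).
  - by apply/measurable_EFinP; exact: measurable_cst.
  - move: ae; apply: filterS; first exact: (ae_filter_ringOfSetsType mu).
    move=> s /= H; rewrite in_itv/= => /andP[s0 st]; rewrite H//.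
    by apply: sub; rewrite /= in_itv/= s0 (le_lt_trans st).
exact: zero_is_derive x0 x1 Jz (integral0_is_derive ic (cf x) x0).
Qed.

End RealParts.

Section Potential.
Local Open Scope complex_scope.
Context {R : realType}.
Local Notation mu := (@lebesgue_measure R).
Variable q : R -> R.
Hypothesis q_int : mu.-integrable `]0, 1[ (EFin \o q).

(** With lower limit at minus infinity the [L^1] norm bounds [Q] on the whole line, while [Q 0 = 0]
    still holds because the extension vanishes left of [0]. *)
Definition potential_primitive (x : R) : R := \int[mu]_(t in `]-oo, x]) zero_ext q t.
Local Notation Q := potential_primitive.

Lemma zero_ext_integrable : mu.-integrable setT (EFin \o zero_ext q).
Proof.
have -> : zero_ext q = q \_ `]0, 1[.
  by apply/funext => x; rewrite /zero_ext patchE mem_setE in_itv.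
by rewrite -restrict_EFin; apply/integrable_restrict => //=; rewrite setTI.
Qed.

Lemma potential_primitiveP : primitive_on setT Q (zero_ext q).
Proof. exact: primitive_on_setT zero_ext_integrable. Qed.

Lemma potential_primitive_cont : continuous Q.
Proof. exact: primitive_on_continuous potential_primitiveP. Qed.

Lemma potential_primitive_le x : `|Q x| <= \int[mu]_t `|zero_ext q t|.
Proof. exact: le_normr_Rintegral_setT zero_ext_integrable. Qed.

Lemma potential_primitive0 : Q 0 = 0.
Proof.
rewrite /potential_primitive -[RHS](mul0r (fine (mu `]-oo, (0 : R)]))) -Rintegral_cst//.
apply: eq_Rintegral => t /set_mem /=; rewrite in_itv/= => t0.
by rewrite /zero_ext ltNge t0.
Qed.

Lemma zero_ext_ge1 x : 1 <= x -> zero_ext q x = 0.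
Proof. by move=> x1; rewrite /zero_ext andbC ltNge x1. Qed.

Lemma potential_primitive_ge1 x : 1 <= x -> Q x = Q 1.
Proof.
move=> x1; apply/eqP; rewrite -subr_eq0; apply/eqP.
have [_ ->] := potential_primitiveP I I x1.
rewrite -[RHS](mul0r (fine (mu `[1, x]))) -Rintegral_cst//.
apply: eq_Rintegral => t /set_mem /=; rewrite in_itv/= => /andP[t1 _].
exact: zero_ext_ge1.
Qed.

Lemma ae_zero_ext : ae_on `[0, 1] q (zero_ext q).
Proof.
exists [set 0; 1]; split.
- by apply: measurableU.
- by rewrite null_set_setU//; exact: lebesgue_measure_set1.
- move=> x /= H; apply: contrapT => nx; apply: H => x01.
  rewrite /zero_ext; move: x01; rewrite in_itv/= => /andP[x0 x1].
  rewrite !lt_neqAle x0 x1 !andbT.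
  case: eqVneq => [E|_]; first by case: nx; left.
  by case: eqVneq => // E; case: nx; right.
Qed.

Lemma solution_scale l k u w : solution Q l u w -> solution Q l (fun x => k * u x) (fun x => k * w x).
Proof.
move=> s; have [cu cw eu ew] := s.
have cv := vel_cont potential_primitive_cont cu cw.
have ca := acc_cont potential_primitive_cont (l := l) cu cw.
split.
- by apply: contM => //; exact: cont_cst.
- by apply: contM => //; exact: cont_cst.
- move=> x; rewrite {1}eu mulrDr; congr (_ + _).
  rewrite /integral0 -RintegralZl//; last exact: continuous_integrable_segment.
  by apply: eq_Rintegral => t _; rewrite /vel; ring.
- move=> x; rewrite {1}ew mulrDr; congr (_ + _).
  rewrite /integral0 -RintegralZl//; last exact: continuous_integrable_segment.
  by apply: eq_Rintegral => t _; rewrite /acc; ring.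
Qed.

(* The boundary condition at [0] is Dirichlet for [d = true], Neumann for [d = false]. *)
Variables (u w : bool -> R -> R -> R).
Hypothesis fam : forall d l, [/\ solution Q l (u d l) (w d l),
  u d l 0 = (~~ d)%:R & w d l 0 = d%:R].

Definition end_value d l : R := u d l 1.
Definition end_slope d l : R := w d l 1 + Q 1 * u d l 1.
Local Notation U := end_value.
Local Notation V := end_slope.

Lemma end_curve d : curve (U d) (V d).
Proof.
apply: (solution_curve potential_primitive_cont potential_primitive_le
  (a0 := (~~ d)%:R) (b0 := d%:R)).
- by move=> l; have [] := fam d l.
- by move=> l; have [] := fam d l.
- by move=> l; have [] := fam d l.
- by case: d; [right|left].
Qed.

Lemma end_wronskian l : U false l * V true l - V false l * U true l = 1.
Proof.
have [s u0 w0] := fam false l; have [s' u'0 w'0] := fam true l.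
have := wronskian_const potential_primitive_cont s s' ler01.
rewrite u0 w0 u'0 w'0 /= mulr1 mul0r subr0 => E; rewrite -[RHS]E.
by rewrite /end_value /end_slope; ring.
Qed.

Lemma real_solution_multiple d l (f f1 p : R -> R) c : 0 < c ->
  ae_on `[0, c] p (zero_ext q) ->
  real_solution_on `[0, c] p l f f1 -> (if d then f 0 else f1 0) = 0 ->
  forall x, 0 <= x -> x <= c -> f x = (if d then f1 0 else f 0) * u d l x /\
    f1 x = (if d then f1 0 else f 0) * vel Q (u d l) (w d l) x.
Proof.
move=> c0 pq [f2 [h1 h2 ae]] b0 x x0 xc; set k := if d then f1 0 else f 0.
have [s u0 w0] := fam d l.
have cQ := potential_primitive_cont.
have ae' : ae_on `[0, c] f2 (fun x => (zero_ext q x - l) * f x).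
  move: pq ae; apply: (@filterS2 _ _ (ae_filter_ringOfSetsType mu)).
  by move=> t /= pt + tc => ->//; rewrite pt.
have [|||-> ->] := ode_solution cQ potential_primitive_le potential_primitive0
  potential_primitiveP c0 (solution_scale k s) _ _ h1 h2 ae' (x := x).
- by rewrite u0 /k; move: b0; case: (d) => /= e; rewrite ?mulr0 ?mulr1 ?e.
- by rewrite w0 /k; move: b0; case: (d) => /= e; rewrite ?mulr0 ?mulr1 ?e.
- by rewrite x0.
by split=> //; rewrite /vel; ring.
Qed.

Lemma family_real_solution d l :
  real_solution_on `[0, +oo[ (zero_ext q) l (u d l) (vel Q (u d l) (w d l)).
Proof.
have [s _ _] := fam d l.
have [h1 h2] := solution_ode potential_primitive_cont potential_primitiveP s.
by exists (fun x => (zero_ext q x - l) * u d l x); split=> //; exact: aeW.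
Qed.

Lemma vel_end d l : vel Q (u d l) (w d l) 1 = V d l.
Proof. by rewrite /vel addrC. Qed.

Lemma vel_start d l : vel Q (u d l) (w d l) 0 = d%:R.
Proof. by have [_ _ w0] := fam d l; rewrite /vel potential_primitive0 mul0r add0r. Qed.

Lemma family_ae_neq0 d l (I : set R) : `]0, 1[ `<=` I -> ~ ae_on I (u d l) (fun=> 0).
Proof.
move=> sub ae; have [s u0 w0] := fam d l; have [cu _ _ _] := s.
have uz := ae_zero_continuous cu sub ae.
have [] := solution_eq0 potential_primitive_cont s uz.
by rewrite u0 w0; case: (d) => /= e1 e2; [move: e2|move: e1] => /eqP; rewrite oner_eq0.
Qed.

Lemma ae_eq_on_toC (I : set R) f : ae_eq_on I (toC f) (fun=> 0) -> ae_on I f (fun=> 0).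
Proof.
apply: filterS; first exact: (ae_filter_ringOfSetsType mu).
by move=> x /= H /H /(congr1 (@complex.Re R)).
Qed.

(** [d] selects the condition at [0] and [e] the one at [1], so that the four choices are the four
    operators on [[0, 1]]. Real and imaginary parts of an eigenfunction are multiples of [u d l],
    hence vanish if the end value in question does not. *)
Lemma eigenvalue_segment (d e : bool) l :
  Defs.eigenvalue (schroedinger `[0, 1] (fun f f1 =>
    (if d then f 0 else f1 0) = 0 /\ (if e then f 1 else f1 1) = 0) q) l <->
  (if e then U d l else V d l) = 0.
Proof.
have mI : measurable (`[0, 1]%classic : set (measurableTypeR R)) by [].
split.
- case=> f /schroedinger_real[f1 [[b0 b1] hre him]] nz.
  apply: contrapT => /eqP end_neq0; apply: nz.
  have key (g g1 : R -> R) : real_solution_on `[0, 1] q l g g1 ->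
      (if d then g 0 else g1 0) = 0 -> (if e then g 1 else g1 1) = 0 ->
      forall x, `[0, 1]%classic x -> g x = 0.
    move=> hg g0 ge x; rewrite /= in_itv/= => /andP[x0 x1].
    have mult := real_solution_multiple ltr01 ae_zero_ext hg g0.
    have [-> _] := mult x x0 x1; have [E1 E2] := mult 1 ler01 (lexx 1).
    have : (if d then g1 0 else g 0) * (if e then U d l else V d l) = 0.
      by rewrite -vel_end; case: (e) ge => ge; rewrite -?E2 -?E1 -[RHS]ge.
    by move=> /eqP; rewrite mulf_eq0 (negbTE end_neq0) orbF => /eqP ->; rewrite mul0r.
  apply: ae_eq_on0.
  + apply: key hre _ _.
      by move: b0; rewrite /re; case: (d) => ->.
    by move: b1; rewrite /re; case: (e) => ->.
  + apply: key him _ _.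
      by move: b0; rewrite /im; case: (d) => ->.
    by move: b1; rewrite /im; case: (e) => ->.
- move=> end0; have [s u0 w0] := fam d l; have [cu _ _ _] := s.
  exists (toC (u d l)).
    apply: (schroedinger_toC (f1 := vel Q (u d l) (w d l)) mI).
    + exact: measurable_funTS (continuous_measurable_fun cu).
    + by apply: continuous_integrable_segment; exact: contX.
    + have [f2 [h1 h2 ae]] := family_real_solution d l.
      have sub : (`[0, 1]%classic : set R) `<=` `[0, +oo[%classic by apply: subset_itv; rewrite bnd_simp.
      exists f2; split; [exact: primitive_onS h1|exact: primitive_onS h2|].
      move: ae_zero_ext ae; apply: (@filterS2 _ _ (ae_filter_ringOfSetsType mu)).
      by move=> t /= pt + tc => ->; [rewrite pt|exact: sub].
    + rewrite /toC; split.
        by rewrite u0 vel_start; case: (d).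
      by move: end0; rewrite vel_end -[u d l 1]/(U d l); case: (e) => ->.
  move=> /ae_eq_on_toC; apply: family_ae_neq0.
  exact: subset_itv_oo_cc.
Qed.

(** Beyond [1] the equation is [u'' = r^2 u], so [u' + r u] satisfies [g' = r g]. It is used for
    both roots, [r = kappa l] and [r = - kappa l], whose difference is [2 kappa l * u]. *)
Lemma solution_tail d l r x : r ^+ 2 = - l -> 1 <= x ->
  Q 1 * u d l x + w d l x + r * u d l x = (V d l + r * U d l) * expR (r * (x - 1)).
Proof.
move=> rl; rewrite le_eqVlt => /predU1P[<-|x1].
  by rewrite subrr mulr0 expR0 mulr1 /end_slope /end_value addrC [w _ _ _ + _]addrC addrC.
have [s _ _] := fam d l; have [cu cw _ _] := s.
pose g t := Q 1 * u d l t + w d l t + r * u d l t.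
pose ex t : R := expR (- (r * t)).
have cex : continuous ex.
  move=> t; apply: (@continuous_comp _ _ _ (fun t => - (r * t)) (@expR R)); last exact: continuous_expR.
  by apply: contN; apply: contM; [exact: cont_cst|exact: cont_id].
have cg : continuous (fun t => g t * ex t).
  apply: contM => //; apply: contD; last by apply: contM => //; exact: cont_cst.
  by apply: contD => //; apply: contM => //; exact: cont_cst.
have [|t [t1 tx]] := mean_value x1 cg (g := fun=> 0).
  move=> t t1 tx; have t0 : 0 < t by exact: lt_trans t1.
  have [du dw] := solution_is_derive potential_primitive_cont s t0.
  have dex := @is_derive1_comp R (@expR R) (fun t => - (r * t)) t _ _
    (is_derive_expR (- (r * t))) (is_derive_opp (is_derive_scale r (is_derive_var t))).
  have dg := is_derive_add (is_derive_add (is_derive_scale (Q 1) du) dw) (is_derive_scale r du).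
  apply: (is_derive_ext (is_derive_mul dg dex)) => //.
  rewrite /= /vel /acc (potential_primitive_ge1 (ltW t1)).
  rewrite -[LHS](@mulr1 R); have -> : l = - r ^+ 2 by rewrite rl opprK.
  by rewrite /g; ring.
rewrite mul0r => /subr0_eq E.
have eK : ex x * expR (r * x) = 1 by rewrite /ex -expRD addNr expR0.
transitivity (g x * ex x * expR (r * x)); first by rewrite -mulrA eK mulr1.
rewrite E /ex -mulrA -expRD /g /end_slope /end_value; congr (_ * expR _); ring.
Qed.

Lemma solution_exp_tail d l x : l < 0 -> 1 <= x ->
  2 * kappa l * u d l x = Robin (U d) (V d) l * expR (kappa l * (x - 1))
    - (V d l - kappa l * U d l) * expR (- (kappa l * (x - 1))).
Proof.
move=> l0 x1; have k2 : kappa l ^+ 2 = - l by rewrite sqr_sqrtr// oppr_ge0 ltW.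
have k2' : (- kappa l) ^+ 2 = - l by rewrite sqrrN.
have := solution_tail d k2 x1; have := solution_tail d k2' x1.
rewrite /Robin !mulNr => <- <-; ring.
Qed.

Lemma ge1_not_integrable (f : R -> R) X : 0 <= X -> (forall x, X <= x -> 1 <= f x) ->
  mu.-integrable `[0, +oo[ (EFin \o f) -> False.
Proof.
move=> X0 f1 fi.
have sub : `[X, +oo[%classic `<=` `[0, +oo[%classic by apply: subset_itv; rewrite bnd_simp.
have /integrableP[mf fX] : mu.-integrable `[X, +oo[ (EFin \o f) by exact: integrableS fi.
have : (\int[mu]_(x in `[X, +oo[) (cst 1 x : \bar R) <= \int[mu]_(x in `[X, +oo[) `|(EFin \o f) x|)%E.
  apply: ge0_le_integral => //.
  - exact: measurableT_comp.
  - move=> x /=; rewrite in_itv/= andbT => Xx; rewrite lee_fin.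
    exact: le_trans (f1 x Xx) (ler_norm _).
have muX : (lebesgue_measure (`[X, +oo[%classic : set R) = +oo)%E.
  by rewrite lebesgue_measure_itv/= ltry.
rewrite integral_cst// mul1e => /le_lt_trans/(_ fX) H.
suff : (+oo < (+oo : \bar R))%E by rewrite ltxx.
by rewrite -{1}muX; exact: H.
Qed.

Lemma half_line_multiple d l (f f1 : R -> R) :
  real_solution_on `[0, +oo[ (zero_ext q) l f f1 -> (if d then f 0 else f1 0) = 0 ->
  forall x, 0 <= x -> f x = (if d then f1 0 else f 0) * u d l x.
Proof.
move=> [f2 [h1 h2 ae]] b0 x x0; have x1 : 0 < x + 1 by lra.
have sub : `[0, (x + 1)]%classic `<=` `[0, +oo[%classic by apply: subset_itv; rewrite bnd_simp.
have pq : ae_on `[0, (x + 1)] (zero_ext q) (zero_ext q) by exact: aeW.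
have h : real_solution_on `[0, (x + 1)] (zero_ext q) l f f1.
  exists f2; split; [exact: primitive_onS h1|exact: primitive_onS h2|].
  move: ae; apply: filterS; first exact: (ae_filter_ringOfSetsType mu).
  by move=> t /= H /sub; exact: H.
by have [|] := real_solution_multiple x1 pq h b0 x0; [lra|].
Qed.

Lemma half_line_real_zero d l (f f1 : R -> R) : l < 0 -> Robin (U d) (V d) l != 0 ->
  real_solution_on `[0, +oo[ (zero_ext q) l f f1 -> (if d then f 0 else f1 0) = 0 ->
  mu.-integrable `[0, +oo[ (EFin \o (fun x => f x ^+ 2)) -> forall x, 0 <= x -> f x = 0.
Proof.
move=> l0 F0 hf b0 fi.
have mult := half_line_multiple hf b0.
set k := (if d then _ else _) in mult.
have [k0|k0] := eqVneq k 0; first by move=> x /mult ->; rewrite k0 mul0r.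
have kl := kappa_gt0 l0.
pose Fl := Robin (U d) (V d) l; pose G := V d l - kappa l * U d l.
have Fp : 0 < `|Fl| by rewrite normr_gt0.
(* For [x >= X] one has [(x - 1) kappa |F| >= 2 kappa + |G|]. With [exp y >= 1 + y] the growing
   exponential then exceeds the decaying one by at least [2 kappa], so that [|u| >= 1]. *)
exfalso; pose X := 1 + (2 * kappa l + `|G|) / (kappa l * `|Fl|).
have kF : 0 < kappa l * `|Fl| by rewrite mulr_gt0.
have X1 : 1 <= X.
  rewrite lerDl; apply: divr_ge0; last exact: ltW.
  by rewrite addr_ge0// mulr_ge0// ltW.
apply: (@ge1_not_integrable (fun x => (u d l x) ^+ 2) X) => //.
- by lra.
- move=> x Xx; have x1 : 1 <= x by exact: le_trans Xx.
  have := solution_exp_tail d l0 x1; rewrite -/Fl -/G => E.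
  have y0 : 0 <= kappa l * (x - 1) by rewrite mulr_ge0 ?subr_ge0// ltW.
  have h : 2 * kappa l <= 2 * kappa l * `|u d l x|.
    rewrite -[X in X * `|_|]ger0_norm; last by lra.
    rewrite -normrM E; apply: le_trans (lerB_dist _ _).
    rewrite !normrM ![`|expR _|]gtr0_norm ?expR_gt0//.
    have e1 : 1 + kappa l * (x - 1) <= expR (kappa l * (x - 1)) by exact: expR_ge1Dx.
    have e2 : expR (- (kappa l * (x - 1))) <= 1 by rewrite -[leRHS]expR0 ler_expR oppr_le0.
    have h1' : `|G| * expR (- (kappa l * (x - 1))) <= `|G| by rewrite ler_piMr.
    have h2' : `|Fl| * (1 + kappa l * (x - 1)) <= `|Fl| * expR (kappa l * (x - 1)) by rewrite ler_pM2l.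
    have h3 : (2 * kappa l + `|G|) <= (x - 1) * (kappa l * `|Fl|).
      by rewrite -ler_pdivrMr//; move: Xx; rewrite /X; lra.
    nra.
  have : 1 <= `|u d l x| by rewrite -(ler_pM2l (_ : 0 < 2 * kappa l)) ?mulr1//; lra.
  by move=> h4; rewrite -real_normK ?num_real// expr_ge1.
- have mI : measurable (`[0, +oo[%classic : set (measurableTypeR R)) by [].
  have := integrableZl mI (k ^- 2) fi.
  apply: eq_integrable => // x /set_mem /=; rewrite in_itv/= andbT => x0.
  by rewrite mult// exprMn -EFinM mulKf// sqrf_eq0.
Qed.

Lemma solution_decay d l : l < 0 -> Robin (U d) (V d) l = 0 ->
  exists c, forall x, 0 <= x -> u d l x ^+ 2 <= c * exponential_pdf (2 * kappa l) x.
Proof.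
move=> l0 F0; have kl := kappa_gt0 l0; have [s _ _] := fam d l; have [cu _ _ _] := s.
have [K _ HK] := EVT_max ler01 (continuous_subspaceT (contX (n := 2) cu)).
pose M := u d l K ^+ 2 + U d l ^+ 2.
have M1 : U d l ^+ 2 <= M by rewrite lerDr sqr_ge0.
(* The majorant, written through an exponential density to have its integrability at hand, is
   [M exp (2 kappa (1 - x))]: at least [M] on [[0, 1]], and decaying like [u^2] beyond. *)
exists (M * expR (2 * kappa l) / (2 * kappa l)) => x x0.
rewrite exponential_pdfE// mulrA divfK ?gt_eqF ?mulr_gt0// -mulrA -expRD.
have [x1|x1] := leP x 1.
  apply: (@le_trans _ _ M).
    rewrite -[leLHS]addr0 lerD ?sqr_ge0//; apply: HK; by rewrite in_itv/= x0.
  rewrite ler_peMr ?addr_ge0 ?sqr_ge0// -[leLHS]expR0 ler_expR.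
  have : kappa l * x <= kappa l by rewrite ler_piMr// ltW.
  lra.
have := solution_exp_tail d l0 (ltW x1); rewrite F0 mul0r sub0r => E.
have Vk : V d l = - (kappa l * U d l) by apply/eqP; rewrite -addr_eq0 -F0.
have {E} -> : u d l x = U d l * expR (- (kappa l * (x - 1))).
  have k2 : 2 * kappa l != 0 by rewrite gt_eqF// mulr_gt0.
  apply: (mulfI k2); rewrite E Vk; ring.
rewrite exprMn -expRM_natl.
have -> : 2%:R * - (kappa l * (x - 1)) = 2 * kappa l + - (2 * kappa l) * x by ring.
by rewrite ler_wpM2r// expR_ge0.
Qed.

Lemma solution_sq_int d l : l < 0 -> Robin (U d) (V d) l = 0 ->
  mu.-integrable `[0, +oo[ (EFin \o (fun x => u d l x ^+ 2)).
Proof.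
move=> l0 F0; have [c hc] := solution_decay l0 F0.
have [s _ _] := fam d l; have [cu _ _ _] := s.
have k2 : 0 < 2 * kappa l by rewrite mulr_gt0// kappa_gt0.
have mI : measurable (`[0, +oo[%classic : set (measurableTypeR R)) by [].
have ie : mu.-integrable `[0, +oo[ (EFin \o exponential_pdf (2 * kappa l)).
  by apply: integrableS (integrable_exponential_pdf k2).
apply: (le_integrable mI _ _ (integrableZl mI c ie)).
- by apply/measurable_EFinP; apply: measurable_funTS; apply: continuous_measurable_fun; exact: contX.
- move=> x /=; rewrite in_itv/= andbT => x0; rewrite lee_fin ger0_norm ?sqr_ge0//.
  exact: le_trans (hc x x0) (ler_norm _).
Qed.

Lemma eigenvalue_half_line (d : bool) l : l < 0 ->
  Defs.eigenvalue (schroedinger `[0, +oo[ (fun f f1 => (if d then f 0 else f1 0) = 0) (zero_ext q)) l <->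
  Robin (U d) (V d) l = 0.
Proof.
move=> l0; have mI : measurable (`[0, +oo[%classic : set (measurableTypeR R)) by [].
have sub01 : (`]0, 1[%classic : set R) `<=` `[0, +oo[%classic by apply: subset_itv; rewrite bnd_simp.
split.
- case=> f ef nz; apply: contrapT => /eqP F0; apply: nz.
  have [sq _ _] := ef; have [i1 i2] := sq_integrable_re mI sq.
  have [f1 [b0 hre him]] := schroedinger_real ef.
  apply: ae_eq_on0 => x; rewrite /= in_itv/= andbT.
    apply: (half_line_real_zero l0 F0 hre _ i1).
    by move: b0; rewrite /re; case: (d) => ->.
  apply: (half_line_real_zero l0 F0 him _ i2).
  by move: b0; rewrite /im; case: (d) => ->.
- move=> F0; have [s u0 w0] := fam d l; have [cu _ _ _] := s.
  exists (toC (u d l)).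
    apply: (schroedinger_toC (f1 := vel Q (u d l) (w d l)) mI).
    + exact: measurable_funTS (continuous_measurable_fun cu).
    + exact: solution_sq_int.
    + exact: family_real_solution.
    + by rewrite /toC u0 vel_start; case: (d).
  by move=> /ae_eq_on_toC; apply: family_ae_neq0.
Qed.

Local Notation pe := (fun x => zero_ext q `|x|).

Lemma ae_oppr (P : R -> Prop) : {ae mu, forall x, P x} -> {ae mu, forall x, P (- x)}.
Proof.
case=> N [mN N0 PN]; exists (-%R @^-1` N); split.
- by rewrite -[X in measurable X]setTI; apply: (@oppr_measurable R setT).
- by rewrite -N0; exact: lebesgue_measureN.
- by move=> x /= nP; apply: PN.
Qed.

(** On the half-line [f x + f (- x)] solves the Neumann problem and [f x - f (- x)] the Dirichlet
    problem; both vanish, hence so does [f]. *)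
Lemma even_real_zero l (f f1 : R -> R) : l < 0 ->
  Robin (U false) (V false) l != 0 -> Robin (U true) (V true) l != 0 ->
  real_solution_on setT pe l f f1 -> mu.-integrable setT (EFin \o (fun x => f x ^+ 2)) ->
  forall x, f x = 0.
Proof.
move=> l0 FN FD [f2 [h1 h2 ae]] fi.
have cf := primitive_on_continuous h1.
have [fiN _] := integral_oppr_setT fi.
have sub : (`[0, +oo[%classic : set R) `<=` setT by [].
have g1 := primitive_onS (fun x _ => I) h1 : primitive_on `[0, +oo[ f f1.
have g2 := primitive_onS (fun x _ => I) h2 : primitive_on `[0, +oo[ f1 f2.
have g1N := primitive_onS (fun x _ => I) (primitive_on_oppr h1) :
  primitive_on `[0, +oo[ (fun x => f (- x)) (fun x => - f1 (- x)).
have g2N := primitive_onS (fun x _ => I) (primitive_on_oppr h2) :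
  primitive_on `[0, +oo[ (fun x => f1 (- x)) (fun x => - f2 (- x)).
have part (d : bool) s : s = (if d then -1 else 1) ->
    forall x, 0 <= x -> 1 * f x + s * f (- x) = 0.
  move=> sE; apply: (@half_line_real_zero d l _ (fun x => 1 * f1 x + s * - f1 (- x))) => //.
  - by case: (d).
  - exists (fun x => 1 * f2 x + (- s) * - f2 (- x)); split.
    + exact: primitive_on_lin g1 g1N.
    + have := primitive_on_lin 1 (- s) g2 g2N.
      rewrite (_ : (fun x => 1 * f1 x + - s * f1 (- x)) =
          (fun x => 1 * f1 x + s * - f1 (- x)))//;
        by apply/funext => x; rewrite mulNr mulrN.
    + move: (ae) (ae_oppr ae); apply: (@filterS2 _ _ (ae_filter_ringOfSetsType mu)).
      move=> x /= e1 e2; rewrite in_itv/= andbT => x0.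
      by rewrite e1// e2// normrN ger0_norm//; ring.
  - by rewrite sE; case: (d); rewrite oppr0 ?mulN1r ?mul1r subrr.
  - apply: (@integrableS _ _ _ mu setT) => //.
    have ii := integrableD measurableT fi fiN.
    apply: (le_integrable measurableT _ _ (integrableZl measurableT 2 ii)).
    + apply/measurable_EFinP; apply: continuous_measurable_fun; apply: contX.
      apply: contD; apply: contM; [exact: cont_cst|exact: cf|exact: cont_cst|].
      move=> x; apply: (@continuous_comp _ _ _ (fun x => - x) f); last exact: cf.
        exact: contN (@cont_id R) x.
    + move=> x _ /=; rewrite lee_fin !ger0_norm ?sqr_ge0//; last first.
        by rewrite mulr_ge0// addr_ge0// sqr_ge0.
      have := sqr_ge0 (f x - f (- x)); have := sqr_ge0 (f x + f (- x)).
      by rewrite sE; case: (d); lra.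
have key x : 0 <= x -> f x = 0 /\ f (- x) = 0.
  move=> x0; have := part false 1 erefl x x0; have := part true (-1) erefl x x0.
  by rewrite !mul1r mulN1r => e1 e2; split; lra.
move=> x; have [x0|x0] := leP 0 x; first by have [] := key x x0.
by have [|_] := key (- x); [lra|rewrite opprK].
Qed.

Lemma primitive_on_congr (I : set R) f f' g g' : primitive_on I f g ->
  (forall a b x, I a -> I b -> a <= x <= b -> I x) ->
  (forall x, I x -> f x = f' x) -> (forall x, I x -> g x = g' x) -> primitive_on I f' g'.
Proof.
move=> H conv ef eg a b Ia Ib ab.
by have := primitive_on_eq H eg conv; move=> /(_ a b Ia Ib ab); rewrite !ef.
Qed.

(** The solution is extended as an odd function in the Dirichlet case and as an even one in the
    Neumann case. *)
Lemma extension_solution (d : bool) l : exists f f1 : R -> R,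
  [/\ real_solution_on setT pe l f f1, forall x, 0 <= x -> f x = u d l x &
      forall x, f x ^+ 2 = u d l `|x| ^+ 2].
Proof.
have [s u0 w0] := fam d l.
have [h1 h2] := solution_ode potential_primitive_cont potential_primitiveP s.
pose v := vel Q (u d l) (w d l); rewrite -/v in h1 h2.
pose c : R := if d then -1 else 1.
have c2 : c ^+ 2 = 1 by rewrite /c; case: (d); rewrite ?sqrrN expr1n.
pose f x := if 0 <= x then u d l x else c * u d l (- x).
pose f1 x := if 0 <= x then v x else - c * v (- x).
pose f2 x := (zero_ext q `|x| - l) * f x.
have convl (a b x : R) : `]-oo, (0 : R)]%classic a -> `]-oo, (0 : R)]%classic b ->
    a <= x <= b -> `]-oo, (0 : R)]%classic x.
  by rewrite /= !in_itv/= => _ b0 /andP[_ xb]; exact: le_trans b0.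
have convr (a b x : R) : `[(0 : R), +oo[%classic a -> `[(0 : R), +oo[%classic b ->
    a <= x <= b -> `[(0 : R), +oo[%classic x.
  by rewrite /= !in_itv/= !andbT => a0 _ /andP[ax _]; exact: le_trans ax.
have subN : (`]-oo, (0 : R)]%classic) `<=` (-%R @^-1` `[(0 : R), +oo[%classic).
  by move=> x /=; rewrite !in_itv/= andbT oppr_ge0.
(* At [x = 0] the two branches agree by the boundary condition; this is what allows gluing there. *)
have neg x : `]-oo, (0 : R)]%classic x -> f x = c * u d l (- x) /\ f1 x = - c * v (- x).
  rewrite /= in_itv/= le_eqVlt => /predU1P[->|x0]; last by rewrite /f /f1 leNgt x0.
  rewrite /f /f1 lexx oppr0 /v vel_start u0 /c.
  by case: (d); rewrite /= ?mulr0 ?mulr1 ?mul1r ?opprK ?mul1r.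
have pos x : `[(0 : R), +oo[%classic x -> f x = u d l x /\ f1 x = v x.
  by rewrite /= in_itv/= andbT /f /f1 => ->.
have n1 := primitive_onS subN (primitive_on_oppr h1).
have n2 := primitive_onS subN (primitive_on_oppr h2).
exists f, f1; split.
- exists f2; split; last exact: aeW.
  + apply: (@primitive_on_glue _ 0).
      apply: (primitive_on_congr (primitive_on_lin c 0 n1 n1) convl) => x Ix /=.
        by rewrite (neg x Ix).1 mul0r addr0.
      by rewrite (neg x Ix).2 mul0r addr0 mulrN mulNr.
    by apply: (primitive_on_congr h1 convr) => x Ix; rewrite ?(pos x Ix).1 ?(pos x Ix).2.
  + apply: (@primitive_on_glue _ 0).
      apply: (primitive_on_congr (primitive_on_lin (- c) 0 n2 n2) convl) => x Ix /=.
        by rewrite (neg x Ix).2 mul0r addr0.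
      rewrite /f2 (neg x Ix).1 mul0r addr0 ler0_norm; first by ring.
      by move: Ix; rewrite /= in_itv.
    apply: (primitive_on_congr h2 convr) => x Ix; first by have [_ ->] := pos x Ix.
    rewrite /f2; have [-> _] := pos x Ix; rewrite ger0_norm//.
    by move: Ix; rewrite /= in_itv/= andbT.
- by move=> x x0; rewrite /f x0.
- move=> x; rewrite /f; have [x0|x0] := leP 0 x; first by rewrite ger0_norm.
  by rewrite ltr0_norm// exprMn c2 mul1r.
Qed.

Lemma eigenvalue_even l : l < 0 -> Defs.eigenvalue (T_even q) l <->
  Robin (U false) (V false) l = 0 \/ Robin (U true) (V true) l = 0.
Proof.
move=> l0; split.
- case=> f ef nz; apply: contrapT => /not_orP[/eqP FN /eqP FD]; apply: nz.
  have [sq _ _] := ef; have [i1 i2] := sq_integrable_re measurableT sq.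
  have [f1 [_ hre him]] := schroedinger_real ef.
  apply: ae_eq_on0 => x _.
    exact: even_real_zero l0 FN FD hre i1 x.
  exact: even_real_zero l0 FN FD him i2 x.
- move=> F0; have [d Fd] : exists d, Robin (U d) (V d) l = 0.
    by case: F0 => ?; [exists false|exists true].
  have [f [f1 [h hpos hsq]]] := extension_solution d l.
  have [f2 [h1 _ _]] := h; have cf := primitive_on_continuous h1.
  have mT : measurable (setT : set (measurableTypeR R)) by [].
  exists (toC f).
    apply: (schroedinger_toC (f1 := f1) mT) => //.
      exact: continuous_measurable_fun.
    have [c hc] := solution_decay l0 Fd.
    have k2 : 0 < 2 * kappa l by rewrite mulr_gt0// kappa_gt0.
    have ie := integrable_exponential_pdf k2; have [ieN _] := integral_oppr_setT ie.
    (* The density at [|x|] is at most the sum of its values at [x] and [- x]; [|c|] is used because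
       the sign of [c] is not recorded. *)
    apply: (le_integrable mT _ _ (integrableZl mT `|c| (integrableD mT ie ieN))).
    + by apply/measurable_EFinP; apply: continuous_measurable_fun; exact: contX.
    + move=> x _ /=; have pdf0 y := @exponential_pdf_ge0 R _ (ltW k2) y.
      rewrite lee_fin ger0_norm ?sqr_ge0// hsq [leRHS]ger0_norm; last first.
        by rewrite mulr_ge0// addr_ge0.
      apply: (le_trans (hc _ (normr_ge0 x))).
      apply: (@le_trans _ _ (`|c| * exponential_pdf (2 * kappa l) `|x|)).
        by rewrite ler_wpM2r// ler_norm.
      rewrite ler_wpM2l//; have [x0|x0] := leP 0 x.
        by rewrite ger0_norm// lerDl.
      by rewrite ltr0_norm// lerDr.
  move=> /ae_eq_on_toC ae.
  apply: (@family_ae_neq0 d l `[0, +oo[) => //.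
    by apply: subset_itv; rewrite bnd_simp.
  move: ae; apply: filterS; first exact: (ae_filter_ringOfSetsType mu).
  by move=> x /= H; rewrite in_itv/= andbT => x0; rewrite -hpos// H.
Qed.

End Potential.

(** * Multiplicities and counting *)

Section Multiplicity.
Local Open Scope complex_scope.
Context {R : realType}.
Local Notation mu := (@lebesgue_measure R).
Variable q : R -> R.
Hypothesis q_int : mu.-integrable `]0, 1[ (EFin \o q).
Local Notation Q := (potential_primitive q).
Variables (u w : bool -> R -> R -> R).
Hypothesis fam : forall d l, [/\ solution Q l (u d l) (w d l),
  u d l 0 = (~~ d)%:R & w d l 0 = d%:R].

Definition half_line (d : bool) : operator R :=
  schroedinger `[0, +oo[ (fun f f1 => (if d then f 0 else f1 0) = 0) (zero_ext q).

Lemma half_line_eigenspace d l f : Defs.eigenspace (half_line d) l f ->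
  exists z : R[i], forall x, 0 <= x -> f x = z * (u d l x)%:C.
Proof.
move=> /schroedinger_real[f1 [b0 hre him]].
have hr := half_line_multiple q_int fam hre (_ : (if d then re f 0 else re f1 0) = 0).
have hi := half_line_multiple q_int fam him (_ : (if d then im f 0 else im f1 0) = 0).
exists ((if d then re f1 0 else re f 0) +i* (if d then im f1 0 else im f 0)) => x x0.
have := hr _ x x0; have := hi _ x x0; rewrite /re /im.
case: (f x) => a b /= -> ; last by move: b0; case: (d) => ->.
move=> -> ; last by move: b0; case: (d) => ->.
by rewrite /GRing.mul /=; congr (_ +i* _); rewrite mulr0 ?subr0 ?add0r.
Qed.

(** All eigenfunctions are complex multiples [z i] of the one solution, so two of them are
    dependent. *)
Lemma half_line_multiplicity d l : l < 0 ->
  Robin (end_value u d) (end_slope q u w d) l = 0 -> multiplicity (half_line d) l = 1%:E.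
Proof.
move=> l0 F0; have [f ef nz] := (eigenvalue_half_line q_int fam d l0).2 F0.
apply/eqP; rewrite eq_le; apply/andP; split.
- apply: ge_ereal_sup => _ [k [e he li] <-]; rewrite lee_fin (ler_nat R k 1) leqNgt.
  apply/negP => k1.
  have [z hz] := choice (fun i => half_line_eigenspace (he i)).
  pose i0 : 'I_k := Ordinal (ltnW k1); pose i1 : 'I_k := Ordinal k1.
  have i01 : i1 != i0 by [].
  have dep (c : 'I_k -> R[i]) : \sum_(i < k) c i * z i = 0 -> forall i, c i = 0.
    move=> cz; apply: li; apply: aeW => x; rewrite /= in_itv/= andbT => x0.
    under eq_bigr do rewrite hz// mulrA.
    by rewrite -mulr_suml cz mul0r.
  (* If [z i0 = 0], the [i0]-th function alone is a dependent family; otherwise [- z i1] and [z i0]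
     are the coefficients of a nontrivial relation. *)
  have [z0|z0] := eqVneq (z i0) 0.
    have E : (1 : R[i]) = 0; last by move/eqP: E; rewrite oner_eq0.
    have := dep (fun i => (i == i0)%:R) _ i0; rewrite eqxx; apply.
    rewrite (bigD1 i0)//= z0 mulr0 add0r big1// => i /negPf ->.
    by rewrite mul0r.
  have := dep (fun i => if i == i0 then - z i1 else if i == i1 then z i0 else 0) _ i1.
  rewrite (negPf i01) eqxx => H; move: z0; rewrite H ?eqxx//.
  rewrite (bigD1 i0)//= (bigD1 i1)//= big1; last first.
    by move=> i /andP[/negPf -> /negPf ->]; rewrite mul0r.
  by rewrite addr0 mulNr mulrC addNr.
- apply: ereal_sup_ubound; exists 1%N => //.
  exists (fun=> f) => // c ae i; rewrite ord1.
  apply: contrapT => /eqP c0; apply: nz.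
  move: ae; apply: filterS; first exact: (ae_filter_ringOfSetsType mu).
  move=> x /= H /H; rewrite big_ord1 => /eqP; rewrite mulf_eq0 (negPf c0) => /eqP //.
Qed.

End Multiplicity.

Section Counting.
Local Open Scope complex_scope.
Context {R : realType}.

(** The sequence increases, so its negative terms form an initial segment; the shift by [k0] makes
    the numbering start at [0]. *)
Lemma enumerates_eigenvalue_sequence (A : operator R) k0 v (f : R -> R) :
  eigenvalue_sequence A k0 v -> (forall l, Defs.eigenvalue A l <-> f l = 0) ->
  enumerates (negative_zeros f) [set j | v (k0 + j)%N < 0] (fun j => v (k0 + j)%N).
Proof.
move=> [lt im] Af.
have vlt i j : (i < j)%N -> v (k0 + i)%N < v (k0 + j)%N.
  by move=> ij; apply: lt; rewrite ?leq_addr// ltn_add2l.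
split.
- move=> i j; rewrite leq_eqVlt => /predU1P[->//|/vlt ij] /= vj; exact: lt_trans vj.
- by move=> i j _; exact: vlt.
- apply/seteqP; split=> [l [l0 /Af El]|_ [j /= vj <-]].
    have : [set l | Defs.eigenvalue A l] l by [].
    rewrite im => -[j /= kj jl]; exists (j - k0)%N => /=; rewrite subnKC//.
    by rewrite jl.
  split=> //; apply/Af; have : [set v j | j in [set j | (k0 <= j)%N]] (v (k0 + j)%N).
    by exists (k0 + j)%N => //=; rewrite leq_addr.
  by rewrite -im.
Qed.

Lemma enumerates_negative_eigenvalues (A : operator R) n E : negative_eigenvalues A n E ->
  enumerates (sigma_d A) [set j | (j < n)%N] (fun j => E j.+1).
Proof.
move=> [lt im]; split.
- by move=> i j /= ij; exact: leq_ltn_trans.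
- by move=> i j /= jn ij; apply: lt.
- rewrite im; apply/seteqP; split=> [_ [[|j] //= jn <-]|_ [j /= jn <-]].
    by exists j.
  by exists j.+1.
Qed.

Lemma enumerates_esum1 (Z : set R) n (e : nat -> R) :
  enumerates Z [set j | (j < n)%N] e -> (\esum_(l in Z) 1 = n%:R%:E :> \bar R)%E.
Proof.
move=> en; rewrite (enum_im en) esum_image; last first.
  move=> i j /set_mem /= iN /set_mem /= jN eij.
  by apply/eqP; case: ltngtP => // ij; have := enum_lt en _ ij;
    rewrite eij ltxx => /(_ _)/=; auto.
rewrite esum_fset; [|exact: finite_II|by move=> *; exact: lee01].
rewrite -[LHS](fsbig_ord _ n (fun=> 1%E)) sumEFin; congr (_%:E).
by rewrite sumr_const card_ord.
Qed.

End Counting.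

Section HalfLineCount.
Local Open Scope complex_scope.
Context {R : realType}.
Local Notation mu := (@lebesgue_measure R).
Variable q : R -> R.
Hypothesis q_int : mu.-integrable `]0, 1[ (EFin \o q).
Local Notation Q := (potential_primitive q).
Variables (u w : bool -> R -> R -> R).
Hypothesis fam : forall d l, [/\ solution Q l (u d l) (w d l),
  u d l 0 = (~~ d)%:R & w d l 0 = d%:R].

Lemma half_line_sigma_d d :
  sigma_d (half_line q d) = negative_zeros (Robin (end_value u d) (end_slope q u w d)).
Proof.
apply/seteqP; split=> l [l0]; first by move=> /(eigenvalue_half_line q_int fam d l0).
by move=> H; split=> //; apply/(eigenvalue_half_line q_int fam d l0).
Qed.

Lemma half_line_n_minus d k n e : n_minus (half_line q d) = k%:R%:E ->
  enumerates (sigma_d (half_line q d)) [set j | (j < n)%N] e -> k = n.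
Proof.
move=> + en; rewrite /n_minus.
have -> : (\esum_(l in sigma_d (half_line q d)) multiplicity (half_line q d) l =
    \esum_(l in sigma_d (half_line q d)) 1)%E.
  apply: eq_esum => l [l0 El]; apply: (half_line_multiplicity q_int fam l0).
  exact/(eigenvalue_half_line q_int fam d l0).
rewrite (enumerates_esum1 en) => -[/eqP]; rewrite eqr_nat => /eqP //.
Qed.

Lemma even_sigma_d : sigma_d (T_even q) = sigma_d (half_line q false) `|` sigma_d (half_line q true).
Proof.
rewrite !half_line_sigma_d; apply/seteqP; split=> l.
  by move=> [l0 /(eigenvalue_even q_int fam l0)[]]; [left|right].
by move=> [] [l0 Fl]; split=> //; apply/(eigenvalue_even q_int fam l0); [left|right].
Qed.

End HalfLineCount.

Theorem corollary1p2 (R : realType) (q : R -> R)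
    (q_int : (@lebesgue_measure R).-integrable `]0, 1[ (EFin \o q))
    (mu nu tau rho : nat -> R)
    (mu_eig : eigenvalue_sequence (L_DD q) 1 mu)
    (nu_eig : eigenvalue_sequence (L_NN q) 0 nu)
    (tau_eig : eigenvalue_sequence (L_DN q) 1 tau)
    (rho_eig : eigenvalue_sequence (L_ND q) 1 rho)
    (m N n_e : nat)
    (m_def : n_minus (T_D q) = m%:R%:E)
    (N_def : n_minus (T_N q) = N%:R%:E)
    (n_e_def : n_minus (T_even q) = n_e%:R%:E)
    (E : nat -> R) (E_eig : negative_eigenvalues (T_even q) n_e E) :
  [/\ sigma_d (T_even q) = sigma_d (T_D q) `|` sigma_d (T_N q),
      n_e = (N + m)%N,
      (1 <= N)%N ->
        (0 <= tau N -> n_e = (2 * N - 1)%N) /\ (tau N < 0 -> n_e = (2 * N)%N),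
      forall j : nat, (1 <= j)%N -> (2 * j - 1 <= n_e)%N ->
        nu (j - 1)%N < E (2 * j - 1)%N /\ E (2 * j - 1)%N < rho j &
      forall j : nat, (1 <= j)%N -> (2 * j <= n_e)%N ->
        tau j < E (2 * j)%N /\ E (2 * j)%N < mu j].

Proof.
have ex (dl : bool * R) : exists uw : (R -> R) * (R -> R),
    [/\ solution (potential_primitive q) dl.2 uw.1 uw.2,
      uw.1 0 = (~~ dl.1)%:R & uw.2 0 = dl.1%:R].
  have [u [w [s u0 w0]]] := solution_exists (potential_primitive_cont q_int)
    (potential_primitive_le q_int) dl.2 (~~ dl.1)%:R dl.1%:R.
  by exists (u, w).
have [uw fam'] := choice ex.
pose u d l := (uw (d, l)).1; pose w d l := (uw (d, l)).2.
have fam d l : [/\ solution (potential_primitive q) l (u d l) (w d l),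
    u d l 0 = (~~ d)%:R & w d l 0 = d%:R] by exact: fam' (d, l).
pose U := end_value u; pose V := end_slope q u w.
pose Z d := negative_zeros (Robin (U d) (V d)).
have crv d : curve (U d) (V d) := end_curve q_int fam d.
(* The Neumann family comes first, so [E 1], [E 3], ... belong to [T_N q]; numbered from [0], these
   are the even positions. *)
have [lF altF] := alternating_FF (crv false) (crv true) (end_wronskian q_int fam).
have eE := enumerates_negative_eigenvalues E_eig.
have sN : sigma_d (T_N q) = Z false := half_line_sigma_d q_int fam false.
have sD : sigma_d (T_D q) = Z true := half_line_sigma_d q_int fam true.
have sE : sigma_d (T_even q) = Z false `|` Z true.
  by rewrite -sN -sD; exact: (even_sigma_d q_int fam).
rewrite sE in eE.
have eN : enumerates (Z false) _ _ := enumerates_even altF eE.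
have eD : enumerates (Z true) _ _ := enumerates_odd altF eE.
(* Hence [N] is half of [n_e] rounded up and [m] half of [n_e] rounded down. *)
have DN : [set j | [set j | (j < n_e)%N] j.*2] = [set j | (j < uphalf n_e)%N].
  by apply/seteqP; split=> j /=; lia.
have DD : [set j | [set j | (j < n_e)%N] j.*2.+1] = [set j | (j < n_e./2)%N].
  by apply/seteqP; split=> j /=; lia.
rewrite DN in eN; rewrite DD in eD.
have NE : N = uphalf n_e.
  by apply: (half_line_n_minus q_int fam (d := false) N_def); rewrite -sN in eN; exact: eN.
have mE : m = n_e./2.
  by apply: (half_line_n_minus q_int fam (d := true) m_def); rewrite -sD in eD; exact: eD.
have e_nu := enumerates_eigenvalue_sequence nu_eig (eigenvalue_segment q_int fam false false).
have e_tau := enumerates_eigenvalue_sequence tau_eig (eigenvalue_segment q_int fam true false).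
have e_rho := enumerates_eigenvalue_sequence rho_eig (eigenvalue_segment q_int fam false true).
have e_mu := enumerates_eigenvalue_sequence mu_eig (eigenvalue_segment q_int fam true true).
have [lN altN] := alternating_VF (crv false); have [lD altD] := alternating_VF (crv true).
have [lN' altN'] := alternating_FU (crv false); have [lD' altD'] := alternating_FU (crv true).
split.
- by rewrite sE sN sD setUC.
- by rewrite NE mE; lia.
- move=> N1; have N1' : (1 + N.-1)%N = N by lia.
  split=> tauN.
    (* If there were an [N]-th eigenvalue of [T_D q], it would be negative and exceed [tau N]. *)
    have : ~ (N.-1 < n_e./2)%N.
      by move=> /(alternating_lt altD e_tau eD)[/= + _]; rewrite N1' ltNge tauN.
    by lia.
  (* Positivity just left of [0] provides an eigenvalue of [T_D q] for each negative term of [tau],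
     hence an [N]-th one. *)
  have [e e0 he] := curve_near0 (crv true).
  have : (N.-1 < n_e./2)%N.
    by apply: (alternating_card altD e_tau eD e0 he); rewrite /= N1'.
  by lia.
- move=> j j1 jn; have jD : (j.-1 < uphalf n_e)%N by lia.
  have [_] := alternating_lt altN e_nu eN jD.
  have -> : (0 + j.-1)%N = (j - 1)%N by lia.
  have Ej : (j.-1.*2.+1)%N = (2 * j - 1)%N by lia.
  rewrite Ej => nuE; split=> //.
  have E0 : E (2 * j - 1)%N < 0.
    by have := enum_in eN jD; rewrite Ej => -[].
  (* Alternation concerns negative zeros only; if [rho j >= 0], the bound holds because the
     eigenvalue is negative. *)
  have [rho0|/(lt_le_trans E0)//] := ltP (rho j) 0.
  have j1' : (1 + j.-1)%N = j by lia.
  have := alternating_lt altN' eN e_rho (j := j.-1).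
  by rewrite /= j1' Ej => /(_ rho0)[].
- move=> j j1 jn; have jD : (j.-1 < n_e./2)%N by lia.
  have j1' : (1 + j.-1)%N = j by lia.
  have Ej : (j.-1.*2.+2)%N = (2 * j)%N by lia.
  have [_] := alternating_lt altD e_tau eD jD; rewrite j1' Ej => tauE; split=> //.
  have E0 : E (2 * j)%N < 0.
    by have := enum_in eD jD; rewrite Ej => -[].
  have [mu0|/(lt_le_trans E0)//] := ltP (mu j) 0.
  have := alternating_lt altD' eD e_mu (j := j.-1).
  by rewrite /= j1' Ej => /(_ mu0)[].
Qed.
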